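(* Let $\mathcal N$ be a finite, locally irreducible, strongly connected and critical abelian network with total alphabet $A$, total kernel $K$, production matrix $P$ and exchange rate vector $\mathbf s$, and let $\mathbb Z^A_0=\{\mathbf z\in\mathbb Z^A:\mathbf s^\top\mathbf z=0\}$. Then: (i) the map $\phi:\mathbb N^A\to\mathrm{End}(\overline{\mathrm{Rec}}(\mathcal N))$, $\phi(\mathbf n)(\overline{\mathbf x.\mathbf q})=\overline{(\mathbf x+\mathbf n).\mathbf q}$, induces an isomorphism of abelian groups $\mathrm{Tor}(\mathcal N)\simeq\mathbb Z^A_0/(I-P)K$; (ii) $\overline{\mathrm{Rec}}(\mathcal N)^\times=\bigsqcup_{m\in\mathbb N\setminus\mathrm{Stop}(\mathcal N)}\overline{\mathrm{Rec}}(\mathcal N,m)$; (iii) for any $m\in\mathbb N\setminus\mathrm{Stop}(\mathcal N)$, the action of the torsion group $\mathrm{Tor}(\mathcal N)\times\overline{\mathrm{Rec}}(\mathcal N,m)\to\overline{\mathrm{Rec}}(\mathcal N,m)$ is free and transitive.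
   Context: Abelian networks. $\mathbb N=\{0,1,2,\dots\}$. Let $G=(V,E)$ be a finite directed graph (self-loops and multiple edges allowed). An abelian network $\mathcal N$ on $G$ assigns to each $v\in V$ a nonempty input alphabet $A_v$ and a nonempty state space $Q_v$ (the $A_v$ pairwise disjoint), maps $T_a:Q_v\to Q_v$ for $a\in A_v$, and, for each edge $e$ from $v$ to $u$, a message-passing function $T_e:Q_v\times A_v\to A_u^*$ (free monoid of words), such that for all $v$, $a,b\in A_v$, $q\in Q_v$: $T_aT_b=T_bT_a$, and for every edge $e$ out of $v$ the words $T_e(q,a)T_e(T_a(q),b)$ and $T_e(q,b)T_e(T_b(q),a)$ agree up to permuting letters. Put $A=\bigsqcup_v A_v$, $Q=\prod_v Q_v$; $\mathcal N$ is finite if $A$ and $Q$ are finite. For a word $w\in A^*$, $|w|\in\mathbb N^A$ counts the occurrences of each letter. For $a\in A_v$, $\mathbf q\in Q$: $t_a\mathbf q$ is $\mathbf q$ with $\mathbf q(v)$ replaced by $T_a(\mathbf q(v))$, and $\mathbf M_a(\mathbf q)=\sum_{e\text{ out of }v}|T_e(\mathbf q(v),a)|\in\mathbb N^A$. A configuration is a pair $\mathbf x.\mathbf q$ with $\mathbf x\in\mathbb Z^A$, $\mathbf q\in Q$; $\pi_a(\mathbf x.\mathbf q)=(\mathbf x+\mathbf M_a(\mathbf q)-|a|).t_a\mathbf q$. For $w=a_1\cdots a_\ell$: $t_w=t_{a_\ell}\cdots t_{a_1}$, $\mathbf M_w(\mathbf q)=\sum_i\mathbf M_{a_i}(t_{a_1\cdots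 a_{i-1}}\mathbf q)$, $\pi_w=\pi_{a_\ell}\cdots\pi_{a_1}$; these depend only on $|w|$, so $t_{\mathbf n},\mathbf M_{\mathbf n},\pi_{\mathbf n}$ are defined for $\mathbf n\in\mathbb N^A$. The word $w$ is legal for $\mathbf x.\mathbf q$ if, with $\mathbf x_i.\mathbf q_i=\pi_{a_1\cdots a_i}(\mathbf x.\mathbf q)$, $\mathbf x_{i-1}(a_i)\ge1$ for all $1\le i\le\ell$. Write $\mathbf x.\mathbf q\xrightarrow{w}\mathbf x'.\mathbf q'$ if $w$ is legal for $\mathbf x.\mathbf q$ and $\pi_w(\mathbf x.\mathbf q)=\mathbf x'.\mathbf q'$; write $\mathbf x.\mathbf q\to\mathbf x'.\mathbf q'$ if this holds for some (possibly empty) $w$. Local recurrence, kernel, production matrix. $\mathcal N$ is locally irreducible if for all $\mathbf q,\mathbf q'\in Q$ there are words $w,w'$ with $t_w\mathbf q=t_{w'}\mathbf q'$. For $\mathcal N$ finite, let $e$ be the product of all idempotents of the finite commutative monoid generated by the $t_a$ in $\mathrm{End}(Q)$; $\mathrm{Loc}(\mathcal N)=eQ$ is the set of locally recurrent states. The total kernel is $K=\{\mathbf z\in\mathbb Z^A: t_{\mathbf z^+}\mathbf q=t_{\mathbf z^-}\mathbf q\ \forall\mathbf q\in\mathrm{Loc}(\mathcal N)\}$, with $\mathbf z^{\pm}\in\mathbb N^A$ the positive/negative parts of $\mathbf z$; it is a finite-index subgroup of $\mathbb Z^A$. For $\mathcal N$ finite and locally irreducible, the production matrix $P$ is the unique rational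 $A\times A$ matrix with $P\mathbf k=\mathbf M_{\mathbf k}(\mathbf q)$ for all $\mathbf k\in K\cap\mathbb N^A$ and $\mathbf q\in\mathrm{Loc}(\mathcal N)$ (it exists and does not depend on $\mathbf q$). $\mathcal N$ is critical if the spectral radius of $P$ is $1$, and strongly connected if the digraph on $A$ with an edge $(a,b)$ whenever $P_{ba}>0$ is strongly connected. Components. Two configurations are legally related if there is $\mathbf x_3.\mathbf q_3$ with $\mathbf x_1.\mathbf q_1\to\mathbf x_3.\mathbf q_3$ and $\mathbf x_2.\mathbf q_2\to\mathbf x_3.\mathbf q_3$ (an equivalence relation). A component of the trajectory digraph (the digraph on configurations with an $a$-labelled edge whenever $\mathbf x.\mathbf q\xrightarrow{a}\mathbf x'.\mathbf q'$) is an equivalence class of this relation; $\overline{\mathbf x.\mathbf q}$ is the component of $\mathbf x.\mathbf q$. An infinite walk is a sequence of configurations $\mathbf x_i.\mathbf q_i$ and letters $a_i$ with $\mathbf x_{i-1}.\mathbf q_{i-1}\xrightarrow{a_i}\mathbf x_i.\mathbf q_i$ for consecutive indices in $I$, where $I$ is $\mathbb Z_{\le0}$, $\mathbb Z_{\ge0}$ or $\mathbb Z$; it is diverse if each letter $a\in A$ equals $a_i$ for infinitely many $i$. A component is recurrent if it contains a diverse infinite walk. $\overline{\mathrm{Rec}}(\mathcal N)$ is the set of recurrent components. Shift monoid and torsion group. $\mathbb N^A$ acts on $\overline{\mathrm{Rec}}(\mathcal N)$ by $\phi(\mathbf n)(\overline{\mathbf x.\mathbf q})=\overline{(\mathbf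 x+\mathbf n).\mathbf q}$; the shift monoid is $\mathscr M(\mathcal N)=\phi(\mathbb N^A)$. $\mathrm{Tor}(\mathcal N)$ is the torsion subgroup of the Grothendieck group of $\mathscr M(\mathcal N)$ (classes $\overline{(m,m')}$ of pairs, $(m_1,m_1')\sim(m_2,m_2')$ iff $mm_1m_2'=mm_1'm_2$ for some $m$). A recurrent component $\overline{\mathbf x.\mathbf q}$ is invertible if for every $g\in\mathrm{Tor}(\mathcal N)$ there is a recurrent component $\overline{\mathbf x'.\mathbf q'}$ such that $\overline{(\mathbf x+\mathbf n).\mathbf q}=\overline{(\mathbf x'+\mathbf n').\mathbf q'}$ for all $\mathbf n,\mathbf n'\in\mathbb N^A$ with $g=\overline{(\phi(\mathbf n),\phi(\mathbf n'))}$; $\overline{\mathrm{Rec}}(\mathcal N)^\times$ is the set of invertible ones, and $\mathrm{Tor}(\mathcal N)$ acts on it by $g\cdot\overline{\mathbf x.\mathbf q}=\overline{\mathbf x'.\mathbf q'}$. Level. The exchange rate vector $\mathbf s$ is the unique positive integer vector in $\mathbb Z^A$ with $\mathbf s^\top P=\mathbf s^\top$ and $\gcd_a\mathbf s(a)=1$. A configuration $\mathbf x.\mathbf q$ halts if $\mathbf x.\mathbf q\to\mathbf x'.\mathbf q'$ for some $\mathbf x'\le\mathbf 0$. $\mathrm{cap}(\mathbf x.\mathbf q)=\sup\{\mathbf s^\top\mathbf z:\mathbf z\in\mathbb Z^A,\ (\mathbf z+\mathbf x).\mathbf q\text{ halts}\}$, $\mathrm{cap}(\mathbf q)=\mathrm{cap}(\mathbf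 0.\mathbf q)$, $\mathrm{cap}(\mathcal N)=\max_{\mathbf q\in Q}\mathrm{cap}(\mathbf q)<\infty$, and $\mathrm{lvl}(\mathbf x.\mathbf q)=\mathrm{cap}(\mathcal N)-\mathrm{cap}(\mathbf x.\mathbf q)$. A configuration is recurrent if it has a nonempty legal execution and every configuration $\mathbf x'.\mathbf q'$ legally related to it satisfies $\mathbf x'.\mathbf q'\to\mathbf x.\mathbf q$. Every recurrent component contains a recurrent configuration, and its level is the (common) level of the recurrent configurations it contains. $\overline{\mathrm{Rec}}(\mathcal N,m)$ is the set of recurrent components of level $m$. The set of stoppable levels is $\mathrm{Stop}(\mathcal N)=\{m\in\mathbb N: m=\mathrm{lvl}(\mathbf x.\mathbf q)\text{ for some }\mathbf x\le\mathbf 0,\ \mathbf q\in\mathrm{Loc}(\mathcal N)\}$. An action is free if $gx=g'x$ implies $g=g'$, and transitive if the set is nonempty and has a single orbit. *)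

(* Defs.v *)
From HB Require Import structures.
From mathcomp Require Import all_boot all_order all_algebra all_field.
From mathcomp Require Import boolp classical_sets cardinality.

Set Implicit Arguments.
Unset Strict Implicit.
Unset Printing Implicit Defensive.

Import Order.TTheory GRing.Theory Num.Theory.
Local Open Scope classical_set_scope.
Local Open Scope quotient_scope.
Local Open Scope ring_scope.

Record digraph := Digraph {
  vertex : finType;
  edge : finType;
  src : edge -> vertex;
  tgt : edge -> vertex
}.

Record abelian_network (G : digraph) := AbelianNetwork {
  letter : vertex G -> finType;
  state : vertex G -> finType;
  letter_nonempty : forall v, inhabited (letter v);
  state_nonempty : forall v, inhabited (state v);
  trans : forall v, letter v -> state v -> state v;
  msg : forall e : edge G,
    state (src e) -> letter (src e) -> seq (letter (tgt e));
  transC : forall v (a b : letter v) q,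
    trans a (trans b q) = trans b (trans a q);
  msgC : forall e a b q,
    perm_eq (msg (e := e) q a ++ msg (trans a q) b)
            (msg q b ++ msg (trans b q) a)
}.

Section Network.
Variables (G : digraph) (N : abelian_network G).

(* The sigma type makes the local alphabets disjoint. *)
Definition alphabet : finType := {v : vertex G & letter N v}.
Definition states : finType := {dffun forall v : vertex G, state N v}.

Definition natvec : nmodType := {ffun alphabet -> nat}.
Definition intvec : zmodType := {ffun alphabet -> int}.

Implicit Types (a b : alphabet) (w : seq alphabet) (n : natvec) (q : states).

Definition letter_count w : natvec := [ffun b => count_mem b w].
Definition toint n : intvec := [ffun b => (n b)%:Z].

(* A word with letter count [n]. *)
Definition word_of n : seq alphabet :=
  flatten [seq nseq (n a) a | a <- enum alphabet].

Definition tstep a q : states :=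
  [ffun u => dfwith q (trans (tagged a) (q (tag a))) u].
Definition tword w q : states := foldl (fun q' a => tstep a q') q w.
Definition tvec n q : states := tword (word_of n) q.

(* The word passed along [e] when letter [a] is processed: empty unless [e]
   leaves the vertex of [a]. *)
Definition emit (e : edge G) q a : seq alphabet :=
  untag (T_ := letter N) [::]
    (fun a' : letter N (src e) =>
       [seq Tagged (letter N) x | x <- msg (q (src e)) a']) a.

Definition Mstep a q : natvec := \sum_(e : edge G) letter_count (emit e q a).
Fixpoint Mword w q : natvec :=
  if w is a :: w' then Mstep a q + Mword w' (tstep a q) else 0.
Definition Mvec n q : natvec := Mword (word_of n) q.

Definition config : Type := intvec * states.
HB.instance Definition _ := Choice.on config.
Implicit Types (c d : config).

Definition add_letters n c : config := (c.1 + toint n, c.2).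

Definition pi_step a c : config :=
  (c.1 + toint (Mstep a c.2) - toint (letter_count [:: a]), tstep a c.2).
Definition pi_word w c : config := foldl (fun c' a => pi_step a c') c w.

Fixpoint legal w c : bool :=
  if w is a :: w' then (1 <= c.1 a) && legal w' (pi_step a c) else true.

Definition exec w c d : Prop := legal w c /\ pi_word w c = d.
Definition reaches c d : Prop := exists w, exec w c d.

Definition legally_related c d : Prop :=
  exists c', reaches c c' /\ reaches d c'.

Definition locally_irreducible : Prop :=
  forall q q', exists w w', tword w q = tword w' q'.

(* [End(Q)] is [{ffun states -> states}], a finite type. *)
Definition fcomp (f g : {ffun states -> states}) : {ffun states -> states} :=
  [ffun q => f (g q)].
Definition fid : {ffun states -> states} := [ffun q => q].
Definition ttword w : {ffun states -> states} := [ffun q => tword w q].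
Definition in_tmonoid (f : {ffun states -> states}) : bool :=
  `[< exists w, f = ttword w >].
(* The monoid is commutative, so the order of the factors is irrelevant. *)
Definition loc_idem : {ffun states -> states} :=
  \big[fcomp/fid]_(f | in_tmonoid f && (fcomp f f == f)) f.
Definition Loc : set states := range loc_idem.

Definition pos_part (z : intvec) : natvec := [ffun a => `|Num.max (z a) 0|%N].
Definition neg_part (z : intvec) : natvec := [ffun a => `|Num.max (- z a) 0|%N].

Definition total_kernel : set intvec :=
  [set z | forall q, Loc q -> tvec (pos_part z) q = tvec (neg_part z) q].

(* Vectors indexed by the alphabet, as column vectors over the canonical
   enumeration of the alphabet. *)
Definition colv (z : intvec) : 'cV[rat]_#|alphabet| :=
  \col_i (z (enum_val i))%:~R.

Definition production_matrix (P : 'M[rat]_#|alphabet|) : Prop :=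
  forall n, total_kernel (toint n) ->
    forall q, Loc q -> P *m colv (toint n) = colv (toint (Mvec n q)).

Definition spectral_radius_is (n : nat) (M : 'M[algC]_n) (r : algC) : Prop :=
  (exists2 l, eigenvalue M l & `|l| = r) /\
  (forall l, eigenvalue M l -> `|l| <= r).

Definition critical (P : 'M[rat]_#|alphabet|) : Prop :=
  spectral_radius_is (map_mx ratr P) 1.

Definition strongly_connected (P : 'M[rat]_#|alphabet|) : Prop :=
  forall a b,
    connect (fun a' b' => 0 < P (enum_rank b') (enum_rank a')) a b.

Definition exchange_rate (P : 'M[rat]_#|alphabet|) (s : intvec) : Prop :=
  [/\ forall a, 0 < s a,
      (colv s)^T *m P = (colv s)^T
    & \big[gcdz/0]_a s a = 1].

Definition component c : set config := [set d | legally_related c d].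

(* An infinite walk inside [C] indexed by [I]; the letter [l i] labels the
   step from index [i - 1] to index [i]. *)
Definition walk_in (I : set int) (C : set config)
    (x : int -> config) (l : int -> alphabet) : Prop :=
  (forall i, I i -> C (x i)) /\
  (forall i, I (i - 1) -> I i -> exec [:: l i] (x (i - 1)) (x i)).
Definition diverse (I : set int) (l : int -> alphabet) : Prop :=
  forall a, infinite_set [set i | [/\ I (i - 1), I i & l i = a]].
Definition walk_range (I : set int) : Prop :=
  [\/ I = [set i | i <= 0], I = [set i | 0 <= i] | I = setT].

Definition recurrent_component (C : set config) : Prop :=
  range component C /\
  exists I x l, [/\ walk_range I, walk_in I C x l & diverse I l].

Definition rec_comp := {C : set config | `[< recurrent_component C >]}.
HB.instance Definition _ := Choice.on rec_comp.

Definition recurrent_config c : Prop :=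
  (exists2 w, w <> [::] & legal w c) /\
  (forall d, legally_related c d -> reaches d c).

Section Level.
Variable s : intvec.

Definition sdot (z : intvec) : int := \sum_a s a * z a.

Definition halts c : Prop :=
  exists2 d, reaches c d & forall a, d.1 a <= 0.
(* [supremum 0 A] defaults to 0 when [A] is empty or unbounded above; neither
   happens for the sets below in a critical network. *)
Definition cap c : int :=
  supremum 0 [set sdot z | z in [set z | halts (z + c.1, c.2)]].
Definition capN : int := supremum 0 [set cap (0, q) | q in setT].
Definition lvl c : int := capN - cap c.

Definition rec_comp_level (m : nat) : set rec_comp :=
  [set C | exists c, [/\ val C c, recurrent_config c & lvl c = m%:Z]].
Definition stoppable : set nat :=
  [set m | exists c, [/\ forall a, c.1 a <= 0, Loc c.2 & m%:Z = lvl c]].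

End Level.

Local Notation mkletter := (@existT _ (fun u => letter N u) _).

Lemma tstep_in v (a : letter N v) q : tstep (mkletter a) q v = trans a (q v).
Proof. by rewrite ffunE dfwith_in. Qed.

Lemma tstep_out a q u : tag a != u -> tstep a q u = q u.
Proof. by move=> au; rewrite ffunE dfwith_out. Qed.

Lemma tstepC a b q : tstep a (tstep b q) = tstep b (tstep a q).
Proof.
case: a b => v a [v' b]; apply/ffunP => u.
case: (eqVneq v u) => [vu|vu]; case: (eqVneq v' u) => [vu'|vu'].
- by subst; do 4![erewrite tstep_in]; rewrite transC.
- by subst; do ![erewrite tstep_in | rewrite tstep_out //].
- by subst; do ![erewrite tstep_in | rewrite tstep_out //].
- by rewrite !tstep_out.
Qed.

Lemma emit_in e q (a : letter N (src e)) :
  emit e q (mkletter a) = [seq Tagged (letter N) x | x <- msg (q (src e)) a].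
Proof. by rewrite /emit untagE. Qed.

Lemma emit_out e q a : tag a != src e -> emit e q a = [::].
Proof. by move=> h; rewrite /emit untag_dflt. Qed.

Lemma letter_count_cat w w' :
  letter_count (w ++ w') = letter_count w + letter_count w'.
Proof. by apply/ffunP => b; rewrite !ffunE count_cat. Qed.

Lemma MstepC a b q :
  Mstep a q + Mstep b (tstep a q) = Mstep b q + Mstep a (tstep b q).
Proof.
rewrite /Mstep -!big_split; apply: eq_bigr => e _ /=.
rewrite -!letter_count_cat; apply/ffunP => c; rewrite !ffunE.
apply: (elimT permP); move: c => _.
case: a b => v a [v' b].
case: (eqVneq v (src e)) => [vu|vu]; case: (eqVneq v' (src e)) => [vu'|vu'].
- subst; rewrite !(emit_in _ a) !(emit_in _ b) (tstep_in a q) (tstep_in b q).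
  by rewrite -!map_cat perm_map // msgC.
- by subst; rewrite !(@emit_out _ _ (mkletter b)) // !(emit_in _ a) cats0 /=
    tstep_out.
- by subst; rewrite !(@emit_out _ _ (mkletter a)) // !(emit_in _ b) cats0 /=
    tstep_out.
- by rewrite !emit_out.
Qed.

Lemma toint0 : toint 0 = 0.
Proof. by apply/ffunP => a; rewrite !ffunE. Qed.

Lemma tointD n n' : toint (n + n') = toint n + toint n'.
Proof. by apply/ffunP => a; rewrite !ffunE PoszD. Qed.

Lemma pi_stepC a b c : pi_step a (pi_step b c) = pi_step b (pi_step a c).
Proof.
rewrite /pi_step /= tstepC; congr (_, _).
rewrite (addrAC _ (- _) (toint (Mstep a _))) (addrAC _ (- _) (toint (Mstep b _))).
by rewrite -!(addrA c.1) -!tointD MstepC addrAC.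
Qed.

Lemma pi_step_le a b c : a != b -> c.1 b <= (pi_step a c).1 b.
Proof.
by move=> ab; rewrite !ffunE /= (negPf ab) addn0 subr0 lerDl.
Qed.

Lemma reaches_refl c : reaches c c. Proof. by exists [::]. Qed.

Lemma legal_cat w w' c :
  legal (w ++ w') c = legal w c && legal w' (pi_word w c).
Proof. by elim: w c => //= a w IH c; rewrite IH andbA. Qed.

Lemma pi_word_cat w w' c : pi_word (w ++ w') c = pi_word w' (pi_word w c).
Proof. exact: foldl_cat. Qed.

Lemma reaches_trans c d c' : reaches c d -> reaches d c' -> reaches c c'.
Proof.
move=> [w [lw <-]] [w' [lw' <-]]; exists (w ++ w').
by split; [rewrite legal_cat lw | rewrite pi_word_cat].
Qed.

Lemma reaches_step a c : 1 <= c.1 a -> reaches c (pi_step a c).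
Proof. by move=> ca; exists [:: a]; split=> //=; rewrite ca. Qed.

Lemma confluent_step a c w : 1 <= c.1 a -> legal w c ->
  exists d, reaches (pi_word w c) d /\ exists w', exec w' (pi_step a c) d.
Proof.
elim: w c => [|b w IH] c ca /=.
  move=> _; exists (pi_step a c); split=> //; first exact: reaches_step.
  by exists [::].
move=> /andP[cb lw]; case: (eqVneq a b) => [ab|ab].
  subst b; exists (pi_word w (pi_step a c)); split.
    exact: reaches_refl.
  by exists w.
have ba : b != a by rewrite eq_sym.
have [|d [rd [w' [lw' dE]]]] := IH (pi_step b c) _ lw.
  exact: le_trans ca (pi_step_le _ ba).
exists d; split=> //; exists (b :: w'); split=> /=.
  by rewrite -pi_stepC lw' (le_trans cb (pi_step_le _ ab)).
by rewrite -pi_stepC.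
Qed.

Lemma confluent c d d' : reaches c d -> reaches c d' ->
  exists e, reaches d e /\ reaches d' e.
Proof.
move=> [w [lw <-]] [w' [lw' <-]]; elim: w c lw w' lw' => [|a w IH] c /=.
  move=> _ w' lw'; exists (pi_word w' c); split; last exact: reaches_refl.
  by exists w'.
move=> /andP[ca lw] w' lw'.
have [d1 [rd1 [w1 [lw1 d1E]]]] := confluent_step ca lw'.
have [e [r1 r2]] := IH _ lw _ lw1.
by exists e; split=> //; apply: reaches_trans rd1 _; rewrite -d1E.
Qed.

Lemma legally_related_refl c : legally_related c c.
Proof. by exists c; split; exact: reaches_refl. Qed.

Lemma legally_related_sym c d : legally_related c d -> legally_related d c.
Proof. by move=> [e [? ?]]; exists e. Qed.

Lemma legally_related_trans c d e :
  legally_related c d -> legally_related d e -> legally_related c e.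
Proof.
move=> [x [cx dx]] [y [dy ey]].
have [z [xz yz]] := confluent dx dy.
by exists z; split; [exact: reaches_trans xz | exact: reaches_trans yz].
Qed.

Lemma component_eqP c d : component c = component d <-> legally_related c d.
Proof.
split=> [cd|cd]; last first.
  apply/seteqP; split=> e /=; apply: legally_related_trans => //.
  exact: legally_related_sym.
have : component d d by exact: legally_related_refl.
by rewrite -cd.
Qed.

Lemma pi_step_add n a c :
  pi_step a (add_letters n c) = add_letters n (pi_step a c).
Proof. by rewrite /pi_step /add_letters /= !(addrAC _ (toint n)). Qed.

Lemma pi_word_add n w c :
  pi_word w (add_letters n c) = add_letters n (pi_word w c).
Proof. by elim: w c => //= a w IH c; rewrite pi_step_add IH. Qed.

Lemma legal_add n w c : legal w c -> legal w (add_letters n c).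
Proof.
elim: w c => //= a w IH c /andP[ca lw]; rewrite pi_step_add IH // andbT.
by rewrite !ffunE (le_trans ca) // lerDl.
Qed.

Lemma exec_add n w c d :
  exec w c d -> exec w (add_letters n c) (add_letters n d).
Proof. by move=> [lw <-]; split; [exact: legal_add | rewrite pi_word_add]. Qed.

Lemma legally_related_add n c d : legally_related c d ->
  legally_related (add_letters n c) (add_letters n d).
Proof.
move=> [e [[w cw] [w' dw]]]; exists (add_letters n e).
by split; [exists w | exists w']; exact: exec_add.
Qed.

(* The component of [(x + n).q] for any [x.q] in the component [C]. *)
Definition shift_set n (C : set config) : set config :=
  \bigcup_(c in C) component (add_letters n c).

Lemma shift_component n c :
  shift_set n (component c) = component (add_letters n c).
Proof.
apply/seteqP; split=> [d [c' cc'] c'd|d cd] /=.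
  exact: legally_related_trans (legally_related_add n cc') c'd.
by exists c => //; exact: legally_related_refl.
Qed.

Lemma shift_recurrent n (C : set config) :
  recurrent_component C -> recurrent_component (shift_set n C).
Proof.
move=> [[c _ cC] [I [x [l [rI [xC xs] dl]]]]]; split.
  by exists (add_letters n c) => //; rewrite -cC shift_component.
exists I, (fun i => add_letters n (x i)), l; split=> //; split=> i Ii.
  by exists (x i); [exact: xC | exact: legally_related_refl].
by move=> Ii'; apply: exec_add; exact: xs.
Qed.

Definition phi n (C : rec_comp) : rec_comp :=
  exist _ (shift_set n (val C))
    (asboolT (shift_recurrent n (asboolW (valP C)))).

Lemma add_letters0 c : add_letters 0 c = c.
Proof. by case: c => x q; rewrite /add_letters toint0 addr0. Qed.

Lemma add_lettersD n n' c :
  add_letters (n + n') c = add_letters n (add_letters n' c).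
Proof. by rewrite /add_letters /= tointD addrA addrAC. Qed.

Lemma phi0 : phi 0 = id.
Proof.
apply/funext => C; apply: val_inj; rewrite [LHS]/= ?[RHS]/=.
have [[c _ cE] _] := asboolW (valP C); rewrite -[\val C]cE.
by rewrite shift_component add_letters0.
Qed.

Lemma phiD n n' : phi (n + n') = phi n \o phi n'.
Proof.
apply/funext => C; apply: val_inj; rewrite [LHS]/= ?[RHS]/=.
have [[c _ cE] _] := asboolW (valP C); rewrite -[\val C]cE.
by rewrite !shift_component add_lettersD.
Qed.

Definition shift_monoid :=
  {f : rec_comp -> rec_comp | `[< exists n, f = phi n >]}.
HB.instance Definition _ := Choice.on shift_monoid.

Definition phiM n : shift_monoid :=
  exist _ (phi n) (asboolT (ex_intro (fun k => phi n = phi k) n erefl)).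

Lemma phiMP (f : shift_monoid) : exists n, f = phiM n.
Proof.
by have [n fn] := asboolW (valP f); exists n; apply: val_inj; rewrite fn.
Qed.

Lemma shift_comp_subproof (f g : shift_monoid) :
  `[< exists n, val f \o val g = phi n >].
Proof.
have [n ->] := phiMP f; have [n' ->] := phiMP g.
by apply/asboolP; exists (n + n'); rewrite phiD.
Qed.

(* The law of the shift monoid is composition, written additively. *)
Definition shift_comp (f g : shift_monoid) : shift_monoid :=
  exist _ (val f \o val g) (shift_comp_subproof f g).
Definition shift_id : shift_monoid := phiM 0.

Lemma phiMD n n' : phiM (n + n') = shift_comp (phiM n) (phiM n').
Proof. by apply: val_inj; rewrite /= phiD. Qed.

Lemma shift_compA : associative shift_comp.
Proof. by move=> f g h; apply: val_inj. Qed.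
Lemma shift_compC : commutative shift_comp.
Proof.
move=> f g; have [n ->] := phiMP f; have [n' ->] := phiMP g.
by rewrite -!phiMD addrC.
Qed.
Lemma shift_comp0 : left_id shift_id shift_comp.
Proof. by move=> f; apply: val_inj; rewrite /= phi0. Qed.

HB.instance Definition _ :=
  GRing.isNmodule.Build shift_monoid shift_compA shift_compC shift_comp0.

End Network.

Section Grothendieck.
Variable M : nmodType.

Definition groth_equiv (p q : M * M) : bool :=
  `[< exists m, m + p.1 + q.2 = m + p.2 + q.1 >].

Lemma groth_equiv_is_equiv : equiv_class_of groth_equiv.
Proof.
split=> [p|p q|q p r].
- by apply/asboolP; exists 0; rewrite -!addrA [p.1 + _]addrC.
- by apply/asboolP/asboolP => -[m mE]; exists m;
    rewrite [LHS]addrAC [RHS]addrAC.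
- move=> /asboolP[m mE] /asboolP[m' mE']; apply/asboolP.
  exists (m + m' + q.1 + q.2).
  transitivity ((m + p.1 + q.2) + (m' + q.1 + r.2)).
    by rewrite !addrA [LHS](+%R.[ACl 1*5*4*2*3*6]).
  by rewrite mE mE' !addrA [LHS](+%R.[ACl 1*4*3*5*2*6]).
Qed.

Canonical groth_equiv_rel := EquivRelPack groth_equiv_is_equiv.
Canonical groth_encModRel := defaultEncModRel groth_equiv.

Definition groth := {eq_quot groth_equiv}.
HB.instance Definition _ := EqQuotient.on groth.
HB.instance Definition _ := Choice.on groth.

(* The class of the pair [(m, m')], i.e. the formal difference [m - m']. *)
Definition groth_class (m m' : M) : groth := \pi_groth (m, m').

Lemma groth_classP (m1 m1' m2 m2' : M) :
  groth_class m1 m1' = groth_class m2 m2' <->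
  exists m, m + m1 + m2' = m + m1' + m2.
Proof.
split=> [/eqmodP/asboolP//|h].
by apply/eqmodP/asboolP.
Qed.

Lemma groth_ind (T : groth -> Prop) :
  (forall m m', T (groth_class m m')) -> forall g, T g.
Proof. by move=> h g; rewrite -[g]reprK; case: (repr g). Qed.

Definition groth_zero : groth := groth_class 0 0.
Definition groth_add (g h : groth) : groth :=
  groth_class ((repr g).1 + (repr h).1) ((repr g).2 + (repr h).2).
Definition groth_opp (g : groth) : groth := groth_class (repr g).2 (repr g).1.

Lemma groth_addE m1 m1' m2 m2' :
  groth_add (groth_class m1 m1') (groth_class m2 m2') =
  groth_class (m1 + m2) (m1' + m2').
Proof.
have h m m' : exists k,
    k + (repr (groth_class m m')).1 + m' = k + (repr (groth_class m m')).2 + m.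
  by apply/groth_classP; rewrite /groth_class -surjective_pairing reprK.
have [k kE] := h m1 m1'; have [k' kE'] := h m2 m2'.
apply/groth_classP; exists (k + k').
move: (repr _) (repr _) kE kE' => [x x'] [y y'] /= kE kE'.
rewrite !addrA [LHS](+%R.[ACl (1*3*5)*(2*4*6)]) kE kE' !addrA.
by rewrite [LHS](+%R.[ACl 1*4*2*5*3*6]).
Qed.

Lemma groth_oppE m m' : groth_opp (groth_class m m') = groth_class m' m.
Proof.
apply/groth_classP.
have /groth_classP[k kE] : groth_class (repr (groth_class m m')).1
    (repr (groth_class m m')).2 = groth_class m m'.
  by rewrite /groth_class -surjective_pairing reprK.
by exists k.
Qed.

Lemma groth_addA : associative groth_add.
Proof.
elim/groth_ind => a a'; elim/groth_ind => b b'; elim/groth_ind => c c'.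
by rewrite !groth_addE !addrA.
Qed.
Lemma groth_addC : commutative groth_add.
Proof.
elim/groth_ind => a a'; elim/groth_ind => b b'.
by rewrite !groth_addE addrC [a' + _]addrC.
Qed.
Lemma groth_add0 : left_id groth_zero groth_add.
Proof. by elim/groth_ind => a a'; rewrite groth_addE !add0r. Qed.
Lemma groth_addN : left_inverse groth_zero groth_opp groth_add.
Proof.
elim/groth_ind => a a'; rewrite groth_oppE groth_addE.
by apply/groth_classP; exists 0; rewrite !addr0 !add0r addrC.
Qed.

HB.instance Definition _ := GRing.isZmodule.Build groth
  groth_addA groth_addC groth_add0 groth_addN.

End Grothendieck.

Section Torsion.
Variable U : zmodType.

Definition torsion_pred : {pred U} :=
  fun g => `[< exists2 k, (0 < k)%N & g *+ k = 0 >].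

Lemma torsion_closed : zmod_closed torsion_pred.
Proof.
split=> [|g h /asboolP[k k0 gk] /asboolP[k' k0' hk]]; apply/asboolP.
  by exists 1%N.
exists (k * k')%N; first by rewrite muln_gt0 k0.
by rewrite mulrnBl mulrnA gk mul0rn mulnC mulrnA hk mul0rn subr0.
Qed.

HB.instance Definition _ := GRing.isZmodClosed.Build U torsion_pred torsion_closed.

Definition torsion := {g : U | torsion_pred g}.
HB.instance Definition _ := SubChoice.on torsion.
HB.instance Definition _ := [SubChoice_isSubZmodule of torsion by <:].

End Torsion.

Section TorsionGroup.
Variables (G : digraph) (N : abelian_network G).

Definition Tor := torsion (groth (shift_monoid N)).
HB.instance Definition _ := GRing.Zmodule.on Tor.

(* [C'] is the result of letting [g] act on [C]. *)
Definition tor_image (g : Tor) (C C' : rec_comp N) : Prop :=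
  forall n n' : natvec N, val g = groth_class (phiM n) (phiM n') ->
    phi n C = phi n' C'.

Definition invertible_comp (C : rec_comp N) : Prop :=
  forall g : Tor, exists C', tor_image g C C'.

(* The default value [C] is irrelevant for invertible components. *)
Definition tor_act (g : Tor) (C : rec_comp N) : rec_comp N :=
  xget C [set C' | tor_image g C C'].

End TorsionGroup.

Section KernelSubgroup.
Variables (G : digraph) (N : abelian_network G).
Implicit Types (a b : alphabet N) (w : seq (alphabet N)) (n : natvec N).
Implicit Types (q : states N) (f g : {ffun states N -> states N}).

Lemma tword_cat w w' q : tword (w ++ w') q = tword w' (tword w q).
Proof. exact: foldl_cat. Qed.

Lemma tword_tstep a w q : tword w (tstep a q) = tstep a (tword w q).
Proof. by elim: w q => //= b w IH q; rewrite tstepC IH. Qed.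

Lemma twordC w w' q : tword w (tword w' q) = tword w' (tword w q).
Proof. by elim: w' q => //= b w' IH q; rewrite IH tword_tstep. Qed.

Lemma tword_perm w w' q : perm_eq w w' -> tword w q = tword w' q.
Proof.
elim: w w' q => [|a w IH] w' q; first by rewrite perm_sym => /perm_nilP ->.
move=> /[dup] /perm_mem/(_ a); rewrite mem_head => /esym/splitPr[w1 w2].
rewrite perm_sym -[a :: w2]cat1s perm_catCA perm_cons perm_sym => h.
by rewrite /= (IH _ _ h) !tword_cat /= tword_tstep.
Qed.

Lemma count_word_of n b : count_mem b (word_of n) = n b.
Proof.
rewrite /word_of count_flatten -map_comp sumnE big_map /=.
rewrite (bigD1_seq b) ?mem_enum ?enum_uniq //= count_nseq /= eqxx mul1n.
by rewrite big1 ?addn0 // => a /negPf ab; rewrite count_nseq /= ab.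
Qed.

Lemma tvecD n n' q : tvec (n + n') q = tvec n (tvec n' q).
Proof.
rewrite /tvec -tword_cat; apply: tword_perm.
apply/allP => b _ /=; rewrite count_cat !count_word_of ffunE addnC.
exact: eqxx.
Qed.

Lemma iter_idem (T : finType) (h : T -> T) :
  exists2 k, (0 < k)%N & forall x, iter (k + k) h x = iter k h x.
Proof.
pose F (i : 'I_#|{ffun T -> T}|.+1) := [ffun x => iter i h x].
have /injectivePn[i [j ij Fij]] : ~~ injectiveb F.
  apply/negP => /injectiveP/leq_card; rewrite card_ord.
  by rewrite ltnn.
wlog lij : i j ij Fij / (i < j)%N.
  by move=> W; case: (ltngtP i j) => [|ji|/val_inj/eqP]; [exact: W
    | apply: (W j i) => //; rewrite eq_sym | rewrite (negPf ij)].
pose p := (j - i)%N; have p0 : (0 < p)%N by rewrite subn_gt0.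
have step m x : (i <= m)%N -> iter (m + p) h x = iter m h x.
  move=> im; rewrite -(subnK im) -addnA /p (subnKC (ltnW lij)).
  by rewrite !iterD; congr iter; move/ffunP/(_ x): Fij; rewrite !ffunE.
exists (i.+1 * p)%N => [|x]; first by rewrite muln_gt0.
have ip : (i <= i.+1 * p)%N by rewrite (leq_trans (leqnSn i)) // leq_pmulr.
move: {1 2 4}(i.+1 * p)%N ip => k ik.
elim: i.+1 => [|t IH]; first by rewrite mul0n addn0.
by rewrite mulSn [(p + _)%N]addnC addnA step // (leq_trans ik) // leq_addr.
Qed.

Lemma ttword_fcompC w w' :
  fcomp (ttword w) (ttword w') = fcomp (ttword w') (ttword w).
Proof. by apply/ffunP => q; rewrite !ffunE twordC. Qed.

Lemma fcompA f g h : fcomp f (fcomp g h) = fcomp (fcomp f g) h.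
Proof. by apply/ffunP => q; rewrite !ffunE. Qed.

Lemma loc_idem_absorb f :
  in_tmonoid f -> fcomp f f = f -> fcomp f (loc_idem N) = loc_idem N.
Proof.
move=> tf ff; rewrite /loc_idem.
have : f \in index_enum {ffun states N -> states N} by rewrite mem_index_enum.
elim: index_enum => // g r IH; rewrite inE big_cons.
have [<- _|fg /= fr] := eqVneq f g; first by rewrite tf ff eqxx fcompA ff.
case: ifP => [/andP[/asboolP[w ->] _]|_]; last exact: IH.
move: tf => /asboolP[w' fE].
by rewrite fcompA fE ttword_fcompC -fE -fcompA IH.
Qed.

Lemma tword_iter w k q :
  tword (flatten (nseq k w)) q = iter k (tword w) q.
Proof. by elim: k q => //= k IH q; rewrite tword_cat IH -iterSr. Qed.

Lemma Loc_tword_inj w q q' : Loc q -> Loc q' ->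
  tword w q = tword w q' -> q = q'.
Proof.
have [k k0 kE] := iter_idem (tword w).
have fixL x : Loc x -> iter k (tword w) x = x.
  move=> [x0 _ <-]; pose f := ttword (flatten (nseq k w)).
  have /ffunP/(_ x0) : fcomp f (loc_idem N) = loc_idem N.
    apply: loc_idem_absorb; first by apply/asboolP; exists (flatten (nseq k w)).
    by apply/ffunP => y; rewrite !ffunE !tword_iter -iterD kE.
  by rewrite [LHS]ffunE ffunE tword_iter.
case: k k0 kE fixL => // k _ _ fixL Lq Lq' e.
by rewrite -(fixL q) // -(fixL q') // !iterSr e.
Qed.

Lemma Loc_tword w q : Loc q -> Loc (tword w q).
Proof.
move=> [q0 _ <-]; exists (tword w q0) => //.
have : in_tmonoid (loc_idem N).
  rewrite /loc_idem; elim/big_ind: _ => [|f g|f /andP[]//].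
    by apply/asboolP; exists [::]; apply/ffunP => y; rewrite !ffunE.
  move=> /asboolP[v ->] /asboolP[v' ->]; apply/asboolP; exists (v' ++ v).
  by apply/ffunP => y; rewrite !ffunE tword_cat.
by move=> /asboolP[v ->]; rewrite !ffunE twordC.
Qed.

Lemma toint_parts (z : intvec N) : z = toint (pos_part z) - toint (neg_part z).
Proof.
apply/ffunP => a; rewrite !ffunE; case: (z a) => m.
  by rewrite (max_idPl _) // (max_idPr _) ?subr0 // oppr_le0.
by rewrite (max_idPr _) // (max_idPl _) // sub0r abszN NegzE.
Qed.

Lemma toint_inj : injective (@toint G N).
Proof. by move=> n n' /ffunP h; apply/ffunP => a; have := h a; rewrite !ffunE => -[]. Qed.

Lemma tvecC n n' q : tvec n (tvec n' q) = tvec n' (tvec n q).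
Proof. exact: twordC. Qed.

Lemma total_kernelP n n' : total_kernel (toint n - toint n') <->
  forall q, Loc q -> tvec n q = tvec n' q.
Proof.
rewrite /total_kernel /=; have := toint_parts (toint n - toint n').
move: (pos_part _) (neg_part _) => p m zE.
have e : n + m = n' + p.
  apply: toint_inj; rewrite !tointD.
  by rewrite -[toint n](subrK (toint n')) zE addrAC subrK addrC.
split=> h q Lq.
- apply: (@Loc_tword_inj (word_of m)); try exact: Loc_tword.
  rewrite -!/(tvec _ _) tvecC -tvecD e tvecD h //; exact: tvecC.
- apply: (@Loc_tword_inj (word_of n')); try exact: Loc_tword.
  rewrite -!/(tvec _ _) -tvecD -e tvecD h //; exact: Loc_tword.
Qed.

Lemma total_kernel0 : total_kernel (0 : intvec N).
Proof. by rewrite -(subrr (toint 0)); apply/total_kernelP. Qed.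

Lemma total_kernelB (z z' : intvec N) :
  total_kernel z -> total_kernel z' -> total_kernel (z - z').
Proof.
rewrite (toint_parts z) (toint_parts z') => /total_kernelP h /total_kernelP h'.
rewrite opprB addrACA -opprD -!tointD; apply/total_kernelP => q Lq.
by rewrite !tvecD h ?h' //; exact: Loc_tword.
Qed.

End KernelSubgroup.

Section Quotient.
Variables (G : digraph) (N : abelian_network G).
Variables (P : 'M[rat]_#|alphabet N|) (s : intvec N).

Definition level_zero_pred : {pred intvec N} := fun z => sdot s z == 0.

Lemma level_zero_closed : zmod_closed level_zero_pred.
Proof.
split=> [|z z' /eqP z0 /eqP z'0]; apply/eqP.
  by rewrite /sdot big1 // => a _; rewrite ffunE mulr0.
rewrite -[RHS](subr0 0) -{1}z0 -z'0 /sdot -sumrB.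
by apply: eq_bigr => a _; rewrite !ffunE mulrBr.
Qed.

HB.instance Definition _ :=
  GRing.isZmodClosed.Build (intvec N) level_zero_pred level_zero_closed.

Definition ZA0 := {z : intvec N | level_zero_pred z}.
HB.instance Definition _ := SubChoice.on ZA0.
HB.instance Definition _ := [SubChoice_isSubZmodule of ZA0 by <:].

(* The subgroup [(I - P) K] of [ZA0]. *)
Definition imageIP_pred : {pred ZA0} := fun z =>
  `[< exists2 k, total_kernel k & colv (val z) = (1%:M - P) *m colv k >].

Lemma colvB (z z' : intvec N) : colv (z - z') = colv z - colv z'.
Proof. by apply/colP => i; rewrite !mxE !ffunE rmorphB. Qed.

Lemma imageIP_closed : zmod_closed imageIP_pred.
Proof.
split=> [|z z' /asboolP[k Kk kE] /asboolP[k' Kk' kE']]; apply/asboolP.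
  exists 0; first exact: total_kernel0.
  by rewrite -[0 in RHS](subrr 0) -[val _](subrr 0) !colvB !subrr mulmx0.
exists (k - k'); first exact: total_kernelB.
by rewrite [val _]raddfB !colvB kE kE' mulmxBr.
Qed.

HB.instance Definition _ :=
  GRing.isZmodClosed.Build ZA0 imageIP_pred imageIP_closed.

Definition ZA0_quot := Quotient.quot (imageIP_pred : zmodClosed ZA0).
HB.instance Definition _ := EqQuotient.on ZA0_quot.
HB.instance Definition _ := GRing.Zmodule.on ZA0_quot.

End Quotient.

Section Actions.
Variables (U : zmodType) (T : Type) (act : U -> T -> T) (X : set T).

Definition action_on : Prop :=
  [/\ forall g x, X x -> X (act g x),
      forall x, X x -> act 0 x = x
    & forall g h x, X x -> act (g + h) x = act g (act h x)].

Definition free_on : Prop :=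
  forall g g' x, X x -> act g x = act g' x -> g = g'.

Definition transitive_on : Prop :=
  X !=set0 /\ forall x y, X x -> X y -> exists g, act g x = y.

End Actions.

(* Main.v *)
(** Call a configuration nonhalting if it does not reach some [x.q] with
   [x <= 0].  A component is recurrent iff its configurations are nonhalting:
   the exchange rate gives a conserved quantity [s.x + h q], which confines an
   infinite legal walk to finitely many configurations, and a loop [w] there has
   [P |w| = |w|], so [|w|] has full support by irreducibility.  Executing a
   letter of a nonhalting configuration, even illegally, stays in the component,
   since that letter is executed legally later on anyway.

   Hence two nonhalting configurations with the same locally recurrent state [q]
   are in the same component iff their difference lies in [(I - P) K].  Shifting
   by [n] and by [n'] therefore agree iff [n - n'] is in [(I - P) K], so the
   Grothendieck group is [Z^A / (I - P) K], whose torsion is the part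
   [s.z = 0], because a left fixed vector of [P] is a multiple of [s].

   On locally recurrent states, halting is invariant under (possibly illegal)
   execution.  So [Z^A_0 / (I - P) K] acts freely and transitively on the
   classes of configurations of a given level [m] up to illegal execution; the
   recurrent components are the nonhalting classes, and a halting class exists
   iff [m] is stoppable. *)
From HB Require Import structures.
Require Import Defs.
From mathcomp Require Import all_boot all_order all_algebra all_field.
From mathcomp Require Import boolp classical_sets cardinality.

Set Implicit Arguments.
Unset Strict Implicit.
Unset Printing Implicit Defensive.

Import Order.TTheory GRing.Theory Num.Theory.
Local Open Scope classical_set_scope.
Local Open Scope quotient_scope.
Local Open Scope ring_scope.

(** * Executions with legality dropped, and the least action principle *)

Section Words.
Variables (G : digraph) (N : abelian_network G).
Implicit Types (a b : alphabet N) (w u v : seq (alphabet N)).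
Implicit Types (c d : config N) (x z : intvec N).

(** Unlike [add_letters], the shift may be negative. It commutes with [pi_word] but need not
    preserve legality. *)
Definition translate z c : config N := (c.1 + z, c.2).

Lemma pi_step_translate z a c :
  pi_step a (translate z c) = translate z (pi_step a c).
Proof. by rewrite /pi_step /translate /= !(addrAC _ z). Qed.

Lemma pi_word_translate z w c :
  pi_word w (translate z c) = translate z (pi_word w c).
Proof. by elim: w c => //= a w IH c; rewrite pi_step_translate IH. Qed.

Lemma translateD z z' c : translate z (translate z' c) = translate (z' + z) c.
Proof. by rewrite /translate /= addrA. Qed.

Lemma translate0 c : translate 0 c = c.
Proof. by case: c => x q; rewrite /translate addr0. Qed.

Lemma pi_wordE w c : pi_word w c =
  (c.1 + toint (Mword w c.2) - toint (letter_count w), tword w c.2).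
Proof.
elim: w c => [|a w IH] [x q] /=.
  have -> : letter_count [::] = 0 :> natvec N.
    by apply/ffunP => b; rewrite !ffunE.
  by rewrite toint0 addr0 subr0.
rewrite IH /= -(cat1s a w) letter_count_cat !tointD opprD addrA.
by congr (_, _); rewrite (addrAC _ (- _) (toint (Mword _ _))) addrA.
Qed.

Lemma pi_word2 w c : (pi_word w c).2 = tword w c.2.
Proof. by rewrite pi_wordE. Qed.

Lemma pi_word_step w a c : pi_word w (pi_step a c) = pi_step a (pi_word w c).
Proof. by elim: w c => //= b w IH c; rewrite pi_stepC IH. Qed.

Lemma pi_wordC w w' c : pi_word w (pi_word w' c) = pi_word w' (pi_word w c).
Proof. by elim: w' c => //= b w' IH c; rewrite IH pi_word_step. Qed.

Lemma pi_word_rem a w c : a \in w ->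
  pi_word (rem a w) (pi_step a c) = pi_word w c.
Proof.
elim: w c => //= b w IH c; rewrite inE.
case: (eqVneq a b) => [->|ab] /= aw; first by [].
by rewrite pi_stepC IH.
Qed.

Lemma pi_word_perm w w' c : perm_eq w w' -> pi_word w c = pi_word w' c.
Proof.
elim: w w' c => [|a w IH] w' c; first by rewrite perm_sym => /perm_nilP ->.
move=> pw; have aw' : a \in w' by rewrite -(perm_mem pw) mem_head.
rewrite -(pi_word_rem _ aw') /=; apply: IH.
by rewrite -(perm_cons a) (perm_trans pw) // perm_to_rem.
Qed.

Lemma pi_word_le w c a : a \notin w -> c.1 a <= (pi_word w c).1 a.
Proof.
elim: w c => //= b w IH c; rewrite inE negb_or => /andP[ab aw].
by apply: le_trans (IH _ aw); apply: pi_step_le; rewrite eq_sym.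
Qed.

(* Performing [a] first, even illegally, only adds letters other than [a], so
   the rest of the execution stays legal. *)
Lemma legal_rem a w c : a \in w -> legal w c -> legal (rem a w) (pi_step a c).
Proof.
elim: w c => //= b w IH c; rewrite inE; case: (eqVneq a b) => [->|ab] /=.
  by move=> _ /andP[].
move=> aw /andP[cb lw].
by rewrite (le_trans cb (pi_step_le _ ab)) -pi_stepC IH.
Qed.

(** Deleting the letters of [u] from [v] one by one leaves a word that is legal after [u], although
    [u] itself may be illegal, and that leads to the end of [v]. *)
Lemma reaches_sub u v c : legal v c ->
  (forall a, count_mem a u <= count_mem a v)%N ->
  reaches (pi_word u c) (pi_word v c).
Proof.
elim: u v c => [|a u IH] v c lv uv /=; first by exists v.
have av : a \in v by rewrite -has_pred1 has_count (leq_trans _ (uv a)) //= eqxx.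
rewrite -(pi_word_rem _ av); apply: IH; first exact: legal_rem.
move=> b; rewrite count_mem_rem; have := uv b; rewrite /= eq_sym.
by rewrite leq_subRL // (leq_trans _ (uv b)) //= eq_sym leq_addr.
Qed.

(** Least action: every letter present in [c] must occur in [w], so it can be executed legally and
    removed from [w]. Induction on the length of [w] then makes the whole execution legal. *)
Lemma halts_pi_word w c : (forall a, (pi_word w c).1 a <= 0) -> halts c.
Proof.
have [n] := ubnP (size w); elim: n w c => // n IH w c szw wc.
have [/existsP[a ca]|] := boolP [exists a, 1 <= c.1 a].
  (* A letter absent from [w] is never consumed, so its count could not have dropped to 0. *)
  have aw : a \in w.
    apply: contraLR (lexx (c.1 a)) => /(pi_word_le c)/le_trans/(_ (wc a)).
    by move/(le_trans ca).
  have [||d rd d0] := IH (rem a w) (pi_step a c).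
  - rewrite size_rem //; case: w aw szw {wc} => //= b w _; exact.
  - by move=> b; rewrite pi_word_rem.
  by exists d => //; apply: reaches_trans (reaches_step ca) rd.
rewrite negb_exists => /forallP c0; exists c; first exact: reaches_refl.
by move=> a; have := c0 a; rewrite -ltNge -[1]add0r ltzD1.
Qed.

Lemma haltsP c : halts c <-> exists w, forall a, (pi_word w c).1 a <= 0.
Proof.
split=> [[d [w [_ <-]] d0]|[w]]; [by exists w | exact: halts_pi_word].
Qed.

Lemma halts_pi w c : halts (pi_word w c) -> halts c.
Proof.
by move=> /haltsP[v wc]; apply/haltsP; exists (w ++ v); rewrite pi_word_cat.
Qed.

Lemma halts_le z c : (forall a, 0 <= z a) -> halts (translate z c) -> halts c.
Proof.
move=> z0 /haltsP[w wc]; apply/haltsP; exists w => a; apply: le_trans (wc a).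
by rewrite pi_word_translate ffunE lerDl.
Qed.

Lemma not_halts_step c : ~ halts c -> exists a, 1 <= c.1 a.
Proof.
move=> nh; apply/existsP; apply: contrapT => /negP; rewrite negb_exists.
move=> /forallP c0; apply: nh; exists c; first exact: reaches_refl.
by move=> a; have := c0 a; rewrite -ltNge -[1]add0r ltzD1.
Qed.

(** Consuming a letter legally requires a count of at least 1 and leaves at least 0, so a legal
    execution creates no new debt. *)
Lemma pi_word_min w c a : legal w c ->
  Num.min (c.1 a) 0 <= (pi_word w c).1 a.
Proof.
elim: w c => [c _|b w IH c /= /andP[cb lw]]; first by rewrite ge_min lexx.
apply: le_trans (IH _ lw); rewrite le_min !ge_min lexx orbT andbT.
have [<-|ba] := eqVneq b a; last by rewrite pi_step_le.
apply/orP; right; rewrite !ffunE /= eqxx addn0 -addrA addrCA.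
by rewrite addr_ge0 // subr_ge0.
Qed.

End Words.

(** * Locally recurrent states and the lattice $(I-P)K$ *)

(** Each side of the first equation is the outcome of an execution: initial letters, plus produced,
    minus consumed. With $k=c-c'$ the second reads $x-x'=k-Pk$. *)
Lemma zmod_rearrange (V : zmodType) (x x' m m' c c' : V) :
  x + m - c = x' + m' - c' <-> x - x' = (c - c') - (m - m').
Proof.
have e : (x + m - c) - (x' + m' - c') = x - x' - ((c - c') - (m - m')).
  rewrite !opprD !opprK !addrA; by rewrite [LHS](+%R.[ACl 1*4*3*6*2*5]).
split=> /eqP h; apply/eqP; move: h;
  by rewrite -subr_eq0 -[_ == _ in X in _ -> X]subr_eq0 e.
Qed.

Section LocalRecurrence.
Variables (G : digraph) (N : abelian_network G).
Implicit Types (a b : alphabet N) (w u v : seq (alphabet N)).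
Implicit Types (q : states N) (x z k : intvec N) (n : natvec N).

(** Some power of [w] acts idempotently, and an injective idempotent is the identity. *)
Lemma tword_period w : exists2 k, (0 < k)%N &
  forall q, Loc q -> tword (flatten (nseq k w)) q = q.
Proof.
have [k k0 kE] := iter_idem (tword w); exists k => // q Lq; rewrite tword_iter.
apply: (@Loc_tword_inj _ _ (flatten (nseq k w))) => //.
  by rewrite -tword_iter; exact: Loc_tword.
by rewrite !tword_iter -iterD kE.
Qed.

(** The idempotent [loc_idem] is a product of elements of the transition monoid, hence the action of
    a single word. *)
Lemma word_to_Loc : exists v, forall q, @Loc G N (tword v q).
Proof.
have : in_tmonoid (loc_idem N).
  rewrite /loc_idem; elim/big_ind: _ => [|f g|f /andP[]//].
    by apply/asboolP; exists [::]; apply/ffunP => y; rewrite !ffunE.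
  move=> /asboolP[v ->] /asboolP[v' ->]; apply/asboolP; exists (v' ++ v).
  by apply/ffunP => y; rewrite !ffunE tword_cat.
move=> /asboolP[v vE]; exists v => q; exists q => //.
by rewrite vE ffunE.
Qed.

Lemma count_power w j a :
  count_mem a (flatten (nseq j w)) = (j * count_mem a w)%N.
Proof. by elim: j => //= j IH; rewrite count_cat IH mulSn. Qed.

Lemma perm_catP u w : (forall a, count_mem a u <= count_mem a w)%N ->
  exists v, perm_eq w (u ++ v).
Proof.
elim: u w => [|a u IH] w uw; first by exists w.
have aw : a \in w by rewrite -has_pred1 has_count (leq_trans _ (uw a)) //= eqxx.
have [b|v pv] := IH (rem a w).
  rewrite count_mem_rem; have := uw b; rewrite /= eq_sym.
  by rewrite leq_subRL // (leq_trans _ (uw b)) //= eq_sym leq_addr.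
by exists v; rewrite (perm_trans (perm_to_rem aw)) //= perm_cons.
Qed.

(** A large power of [w] fixes [q] and contains, up to order, a word sending every state into
    [Loc]. *)
Lemma Loc_loop w q : (forall a, a \in w) -> tword w q = q -> Loc q.
Proof.
move=> fw wq; have [v vL] := word_to_Loc.
have [|u pu] := @perm_catP v (flatten (nseq (size v) w)).
  move=> a; rewrite count_power (leq_trans (count_size _ _)) // leq_pmulr //.
  by rewrite -has_count has_pred1.
have <- : tword (flatten (nseq (size v) w)) q = q.
  by rewrite tword_iter; elim: (size v) => //= j ->.
by rewrite (tword_perm _ pu) tword_cat; apply: Loc_tword.
Qed.

Lemma tvec_count w q : tvec (letter_count w) q = tword w q.
Proof.
apply: tword_perm; apply/allP => b _ /=.
by rewrite count_word_of ffunE.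
Qed.

Lemma tvec0 q : tvec 0 q = q.
Proof.
rewrite -[RHS]/(tword [::] q) -tvec_count.
by congr tvec; apply/ffunP => a; rewrite !ffunE.
Qed.

(** Inherited from [pi_word] started at zero letters, after cancelling the letters consumed. *)
Lemma Mword_perm u v q : perm_eq u v -> Mword u q = Mword v q.
Proof.
move=> uv; have := pi_word_perm (0, q) uv; rewrite !pi_wordE => -[+ _] /=.
have -> : letter_count u = letter_count v.
  by apply/ffunP => a; rewrite !ffunE (permP uv).
by move=> /addIr/addrI/toint_inj.
Qed.

Lemma Mvec_count w q : Mvec (letter_count w) q = Mword w q.
Proof.
apply: Mword_perm; apply/allP => b _ /=.
by rewrite count_word_of ffunE.
Qed.

Lemma letter_count_word_of n : letter_count (word_of n) = n.
Proof. by apply/ffunP => a; rewrite ffunE count_word_of. Qed.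

Lemma Mword_cat u v q : Mword (u ++ v) q = Mword u q + Mword v (tword u q).
Proof. by elim: u q => [|a u IH] q /=; rewrite ?add0r // IH addrA. Qed.

Lemma total_kernelN z : total_kernel z -> total_kernel (- z).
Proof. by rewrite -(sub0r z); apply: total_kernelB; exact: total_kernel0. Qed.

Lemma total_kernelD z z' :
  total_kernel z -> total_kernel z' -> total_kernel (z + z').
Proof.
by move=> Kz Kz'; rewrite -[z']opprK; apply: total_kernelB => //;
  exact: total_kernelN.
Qed.

Lemma total_kernelMn z j : total_kernel z -> total_kernel (z *+ j).
Proof.
move=> Kz; elim: j => [|j IH]; first exact: total_kernel0.
by rewrite mulrS; exact: total_kernelD.
Qed.

Lemma total_kernel_period n :
  exists2 j, (0 < j)%N & total_kernel (toint n *+ j).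
Proof.
have [j j0 jE] := tword_period (word_of n); exists j => //.
have -> : toint n *+ j = toint (letter_count (flatten (nseq j (word_of n))))
    - toint 0.
  rewrite toint0 subr0; apply/ffunP => a.
  rewrite ffunMnE !ffunE count_power count_word_of.
  by rewrite -mulr_natl natz PoszM.
by apply/total_kernelP => q Lq; rewrite tvec_count jE // tvec0.
Qed.

(** The positive and negative parts each have a multiple in the kernel. The product of the two
    multipliers serves both. *)
Lemma total_kernel_finite_index z :
  exists2 j, (0 < j)%N & total_kernel (z *+ j).
Proof.
have [j j0 Kj] := total_kernel_period (pos_part z).
have [l l0 Kl] := total_kernel_period (neg_part z).
exists (j * l)%N; first by rewrite muln_gt0 j0.
rewrite (toint_parts z) mulrnBl; apply: total_kernelB.
  by rewrite mulrnA; exact: total_kernelMn.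
by rewrite mulnC mulrnA; exact: total_kernelMn.
Qed.

Lemma colv_inj : injective (@colv G N).
Proof.
move=> z z' /colP h; apply/ffunP => a; apply/eqP; rewrite -(eqr_int rat).
by have := h (enum_rank a); rewrite !mxE enum_rankK => ->.
Qed.

Lemma colvD z z' : colv (z + z') = colv z + colv z'.
Proof. by apply/colP => i; rewrite !mxE !ffunE rmorphD. Qed.

Lemma colv0 : colv (0 : intvec N) = 0.
Proof. by apply/colP => i; rewrite !mxE !ffunE. Qed.

Lemma colvMn z j : colv (z *+ j) = colv z *+ j.
Proof. by elim: j => [|j IH]; rewrite ?mulr0n ?colv0 // !mulrS colvD IH. Qed.

Hypothesis irr : locally_irreducible N.

(** Irreducibility gives [u], [v] merging [q] and [q']. As [v] has a period [j.+1] on [Loc],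
    following [u] by [j] further copies of [v] undoes [v]. *)
Lemma tword_transitive q q' : Loc q' -> exists w, tword w q = q'.
Proof.
move=> Lq'; have [u [v uv]] := irr q q'.
have [[//|j] _ jE] := tword_period v; exists (flatten (nseq j v) ++ u).
by rewrite tword_cat twordC uv -tword_cat -[RHS](jE _ Lq') /= !tword_cat twordC.
Qed.

(** Agreement at one state spreads to all of [Loc], by transitivity and commutation. *)
Lemma total_kernel_words u v q : Loc q -> tword u q = tword v q ->
  total_kernel (toint (letter_count u) - toint (letter_count v)).
Proof.
move=> Lq uv; apply/total_kernelP => q' Lq'.
have [w <-] := tword_transitive q Lq'.
by rewrite !tvec_count twordC uv twordC.
Qed.

Variable P : 'M[rat]_#|alphabet N|.
Hypothesis prodP : production_matrix P.

(** The equation defining [P] covers only words that act trivially on [Loc]. Appending to [u] and to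
    [v] the same word [w] leading back to [q] gives two such words, and the contribution of [w]
    cancels. *)
Lemma production_words u v q : Loc q -> tword u q = tword v q ->
  colv (toint (Mword u q) - toint (Mword v q)) =
  P *m colv (toint (letter_count u) - toint (letter_count v)).
Proof.
move=> Lq uv; have [w wE] := tword_transitive (tword u q) Lq.
(* The last bracket is the correction due to [w], the same for every [t]. *)
have H t : tword t q = tword u q -> colv (toint (Mword t q)) =
   P *m colv (toint (letter_count t)) +
     (P *m colv (toint (letter_count w)) - colv (toint (Mword w (tword u q)))).
  move=> tE; have : P *m colv (toint (letter_count (t ++ w))) =
      colv (toint (Mword (t ++ w) q)).
    rewrite -(Mvec_count _ q); apply: prodP => //.
    rewrite -[toint _]subr0 -(toint0 N).
    apply/total_kernelP => q' Lq'; have [t' <-] := tword_transitive q Lq'.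
    rewrite tvec_count twordC tword_cat tE wE.
    by rewrite tvec0.
  rewrite letter_count_cat Mword_cat tE !tointD !colvD mulmxDr addrA => ->.
  by rewrite addrK.
by rewrite !colvB (H u) // (H v) // opprD addrACA subrr addr0 mulmxBr.
Qed.

(* The subgroup [(I - P) K] of [Z^A]. *)
Definition lattice z :=
  exists2 k, total_kernel k & colv z = (1%:M - P) *m colv k.

Lemma lattice0 : lattice 0.
Proof. by exists 0; [exact: total_kernel0 | rewrite !colv0 mulmx0]. Qed.

(** The kernel element is $|u|-|v|$. Conversely, the next lemma takes for [u] and [v] the positive
    and negative parts of a kernel element. *)
Lemma lattice_pi_word u v x x' q : Loc q ->
  pi_word u (x, q) = pi_word v (x', q) -> lattice (x - x').
Proof.
rewrite !pi_wordE /= => Lq [xE uv].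
exists (toint (letter_count u) - toint (letter_count v)).
  exact: total_kernel_words uv.
rewrite mulmxBl mul1mx -(production_words Lq uv) -colvB; congr colv.
exact/zmod_rearrange.
Qed.

Lemma pi_word_lattice x x' q : Loc q -> lattice (x - x') ->
  exists u v, pi_word u (x, q) = pi_word v (x', q).
Proof.
move=> Lq [k Kk kE].
pose u := word_of (pos_part k); pose v := word_of (neg_part k).
have uv : tword u q = tword v q by exact: Kk.
have := production_words Lq uv; rewrite !letter_count_word_of -toint_parts => e.
exists u, v; rewrite !pi_wordE uv /= !letter_count_word_of; congr (_, _).
move: kE; rewrite mulmxBl mul1mx -e -colvB => /colv_inj.
rewrite {1}(toint_parts k) => xE.
exact/zmod_rearrange.
Qed.

End LocalRecurrence.

(** * Perron-Frobenius positivity, loops and the conserved quantity *)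

Lemma connect_ind (T : finType) (e : rel T) (p : T -> Prop) :
  (forall a b, connect e a b) -> (forall a b, e a b -> p a -> p b) ->
  forall a b, p a -> p b.
Proof.
move=> ce step a b pa; have /connectP[l] := ce a b.
by elim: l a pa => [|c l IH] a pa /= => [_ ->//|/andP[/step/(_ pa)]]; apply: IH.
Qed.

Section ProductionMatrix.
Variables (G : digraph) (N : abelian_network G).
Implicit Types (a b : alphabet N) (w u v : seq (alphabet N)).
Implicit Types (q : states N) (x z k : intvec N) (n : natvec N).
Implicit Types (c d : config N).

Lemma states_nonempty : exists q : states N, True.
Proof.
have f (r : vertex G) : state N r.
  have [y _] := cid
    (let: inhabits y := state_nonempty N r in ex_intro xpredT y isT).
  exact: y.
by exists (finfun f).
Qed.

Lemma Loc_nonempty : exists q, @Loc G N q.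
Proof.
have [q _] := states_nonempty; have [v vL] := word_to_Loc N.
by exists (tword v q).
Qed.

Lemma tointMn n j : toint (n *+ j) = toint n *+ j.
Proof. by elim: j => [|j IH]; rewrite ?mulr0n ?toint0 // !mulrS tointD IH. Qed.

Hypothesis irr : locally_irreducible N.
Variable P : 'M[rat]_#|alphabet N|.
Hypothesis prodP : production_matrix P.
Hypothesis conP : strongly_connected P.

(** A positive multiple of each unit vector lies in the kernel, so a multiple of each column of [P]
    counts messages. *)
Lemma production_ge0 i j : 0 <= P i j.
Proof.
have [q Lq] := Loc_nonempty; pose a := enum_val j.
have [l l0] := total_kernel_period (letter_count [:: a]).
rewrite -tointMn => Kl; have /colP/(_ i) := prodP Kl Lq.
rewrite mxE (bigD1 j) //= big1 => [|j' j'j].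
  rewrite addr0 !mxE !ffunE ffunMnE !ffunE /= eqxx => e.
  rewrite -(@pmulr_lge0 _ (l%:R)) ?ltr0n //.
  have -> : l%:R = ((1 + 0)%N *+ l)%:~R :> rat by rewrite addn0 natn.
  by rewrite e.
rewrite !mxE !ffunE ffunMnE !ffunE /= (_ : a == _ = false) ?mul0rn ?mulr0 //.
by rewrite (inj_eq enum_val_inj) eq_sym (negPf j'j).
Qed.

(** A positive entry makes the entries at its successors positive, and strong connectivity carries
    this everywhere. *)
Lemma fixed_vector_pos (y : 'cV[rat]_#|alphabet N|) :
  (forall i, 0 <= y i 0) -> P *m y = y -> y != 0 -> forall i, 0 < y i 0.
Proof.
move=> y0 Py yn0; have [i yi] : exists i, 0 < y i 0.
  apply/existsP; apply: contraR yn0; rewrite negb_exists => /forallP h.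
  apply/eqP/colP => i; rewrite mxE; apply/eqP; rewrite eq_le y0 andbT leNgt.
  exact: h.
move=> j; rewrite -(enum_valK j).
apply: (connect_ind (p := fun a => 0 < y (enum_rank a) 0) conP) (enum_val i) _ _.
  move=> a b Pab ya; rewrite -Py mxE (bigD1 (enum_rank a)) //=.
  by rewrite ltr_pwDl ?mulr_gt0 // sumr_ge0 // => l _;
    rewrite mulr_ge0 ?production_ge0.
by rewrite enum_valK.
Qed.

Lemma fixed_covector_pos (y : 'rV[rat]_#|alphabet N|) :
  (forall i, 0 <= y 0 i) -> y *m P = y -> y != 0 -> forall i, 0 < y 0 i.
Proof.
move=> y0 Py yn0; have [i yi] : exists i, 0 < y 0 i.
  apply/existsP; apply: contraR yn0; rewrite negb_exists => /forallP h.
  apply/eqP/rowP => i; rewrite mxE; apply/eqP; rewrite eq_le y0 andbT leNgt.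
  exact: h.
move=> j; rewrite -(enum_valK j); apply: contrapT => /negP yj.
(* For a row vector positivity travels against the edges, so it is vanishing that propagates along
   them. *)
have := connect_ind (p := fun a => ~~ (0 < y 0 (enum_rank a))) conP _
  (enum_val i) yj; rewrite enum_valK yi => /(_ _)/negP; apply => //.
move=> a b Pab; apply: contra => yb.
rewrite -Py mxE (bigD1 (enum_rank b)) //=.
by rewrite ltr_pwDl ?mulr_gt0 // sumr_ge0 // => l _;
    rewrite mulr_ge0 ?production_ge0.
Qed.

(** Executing a word into [Loc] first keeps the loop closed. There, production equals consumption,
    so $|w|$ is a nonzero nonnegative fixed vector of [P], hence positive everywhere. *)
Lemma loop_kernel w c : w <> [::] -> pi_word w c = c ->
  [/\ total_kernel (toint (letter_count w)),
      P *m colv (toint (letter_count w)) = colv (toint (letter_count w))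
    & forall a, a \in w].
Proof.
move=> w0 wc; have [v vL] := word_to_Loc N.
have : pi_word w (pi_word v c) = pi_word v c by rewrite pi_wordC wc.
case: (pi_word v c) (pi_word2 v c) => x q /= qE.
have {qE} Lq : Loc q by rewrite qE.
rewrite pi_wordE /= => -[e tw].
have Mw : toint (Mword w q) = toint (letter_count w).
  by move/eqP: e; rewrite -addrA -subr_eq0 addrAC subrr add0r subr_eq0 => /eqP.
have := total_kernel_words irr Lq (tw : tword w q = tword [::] q).
have := production_words irr prodP Lq (tw : tword w q = tword [::] q).
have -> : letter_count [::] = 0 :> natvec N by apply/ffunP => b; rewrite !ffunE.
rewrite /= Mw toint0 !subr0 => /esym Pw Kw; split=> // a.
have := @fixed_vector_pos (colv (toint (letter_count w))) _ Pw _ (enum_rank a).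
rewrite mxE !ffunE enum_rankK => pa; rewrite -has_pred1 has_count.
rewrite -(@ltr0n rat); apply: pa => [i|]; first by rewrite mxE !ffunE ler0n.
case: w w0 {wc Mw tw Pw Kw e} => // b w _.
apply/eqP => /colP/(_ (enum_rank b))/eqP; rewrite !mxE !ffunE enum_rankK /= eqxx.
by rewrite intr_eq0.
Qed.

Lemma loop_Loc w c : w <> [::] -> pi_word w c = c -> Loc c.2.
Proof.
move=> w0 wc; have [_ _ fw] := loop_kernel w0 wc; apply: (Loc_loop fw).
by rewrite -pi_word2 wc.
Qed.

(** Being a loop over [Loc] depends only on the letter count, so one loop closes up at every locally
    recurrent state. *)
Lemma kernel_fixed_loop w c : total_kernel (toint (letter_count w)) ->
  P *m colv (toint (letter_count w)) = colv (toint (letter_count w)) ->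
  Loc c.2 -> pi_word w c = c.
Proof.
case: c => x q Kw Pw /= Lq; rewrite pi_wordE /= -Mvec_count.
have := prodP Kw Lq; rewrite Pw => /colv_inj <-; rewrite addrK.
congr (_, _); have := Kw; rewrite -[toint _]subr0 -(toint0 N).
by move/total_kernelP/(_ _ Lq); rewrite tvec_count tvec0.
Qed.

Section ExchangeRate.
Variable s : intvec N.

Lemma sdotD z z' : sdot s (z + z') = sdot s z + sdot s z'.
Proof. by rewrite -big_split; apply: eq_bigr => a _; rewrite ffunE mulrDr. Qed.

Lemma sdotN z : sdot s (- z) = - sdot s z.
Proof. by rewrite -sumrN; apply: eq_bigr => a _; rewrite ffunE mulrN. Qed.

Lemma sdotB z z' : sdot s (z - z') = sdot s z - sdot s z'.
Proof. by rewrite sdotD sdotN. Qed.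

Lemma sdot0 : sdot s 0 = 0.
Proof. by rewrite -(subrr 0) sdotB subrr. Qed.

Lemma sdotMn z j : sdot s (z *+ j) = sdot s z *+ j.
Proof. by elim: j => [|j IH]; rewrite ?mulr0n ?sdot0 // !mulrS sdotD IH. Qed.

Lemma sdot_colv z : ((colv s)^T *m colv z) 0 0 = (sdot s z)%:~R.
Proof.
rewrite mxE (reindex _ (onW_bij _ (@enum_rank_bij (alphabet N)))) rmorph_sum.
by apply: eq_bigr => a _; rewrite !mxE enum_rankK rmorphM.
Qed.

Hypothesis sP : (colv s)^T *m P = (colv s)^T.

Lemma sdot_lattice z : lattice P z -> sdot s z = 0.
Proof.
move=> [k _ kE]; apply/eqP; rewrite -(intr_eq0 rat) -sdot_colv kE mulmxA.
by rewrite mulmxBr mulmx1 sP subrr mul0mx mxE.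
Qed.

(** The potential [h q] is the [s]-weight left when a chosen word leads [0.q] to a reference state.
    Changing the route alters the letters by an element of $(I-P)K$, which [s] annihilates. *)
Lemma invariant_exists : exists h : states N -> int, forall w c,
  sdot s (pi_word w c).1 + h (pi_word w c).2 = sdot s c.1 + h c.2.
Proof.
have [q0 L0] := Loc_nonempty.
have [f fE] := choice (fun q => tword_transitive irr q L0).
exists (fun q => sdot s (pi_word (f q) (0, q)).1) => w c.
have H d : sdot s d.1 + sdot s (pi_word (f d.2) (0, d.2)).1 =
    sdot s (pi_word (f d.2) d).1.
  rewrite -sdotD !pi_wordE /=; congr sdot.
  by rewrite add0r addrA.
have fE' d : ((pi_word (f d.2) d).1, q0) = pi_word (f d.2) d.
  by rewrite pi_wordE fE.
rewrite !H; apply/eqP; rewrite -subr_eq0 -sdotB; apply/eqP.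
apply: sdot_lattice; apply: (lattice_pi_word irr prodP (q := q0)
  (u := f c.2) (v := w ++ f (tword w c.2))) => //.
rewrite -pi_word2 !fE' pi_word_cat.
by rewrite [in RHS](pi_wordC w) [in RHS](pi_wordC (f _)).
Qed.

End ExchangeRate.
End ProductionMatrix.

(** * Legal cycles and the characterisation of recurrent components *)

Section Cycles.
Variables (G : digraph) (N : abelian_network G).
Implicit Types (a b : alphabet N) (w u v : seq (alphabet N)).
Implicit Types (q : states N) (x z : intvec N) (n : nat).
Implicit Types (c d r : config N).

(** A concrete form of recurrence for configurations; [recurrent_configP] proves the equivalence. *)
Definition cyclic_config c := exists2 w, w <> [::] & exec w c c.

Lemma exec_chain (f : nat -> config N) n :
  (forall k, (k < n)%N -> exists a, exec [:: a] (f k) (f k.+1)) ->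
  exists2 w, size w = n & exec w (f 0%N) (f n).
Proof.
elim: n => [|n IH] step; first by exists [::].
have [|w wn [lw wE]] := IH; first by move=> k /ltnW; exact: step.
have [a [la aE]] := step n (ltnSn n); exists (rcons w a).
  by rewrite size_rcons wn.
by rewrite -cats1; split; rewrite ?legal_cat ?pi_word_cat ?lw wE.
Qed.

Lemma stuck_reaches c d : (forall a, c.1 a <= 0) -> reaches c d -> d = c.
Proof.
move=> c0 [[|a w] [/= + <- //]].
by move=> /andP[/le_trans/(_ (c0 a))].
Qed.

Lemma halts_related c d : legally_related c d -> halts c -> halts d.
Proof.
move=> [m [cm dm]] [e ce e0]; have [z [ez mz]] := confluent ce cm.
exists e => //; rewrite -(stuck_reaches e0 ez); exact: reaches_trans mz.
Qed.

Lemma legal_power w c j : legal w c -> pi_word w c = c ->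
  legal (flatten (nseq j w)) c /\ pi_word (flatten (nseq j w)) c = c.
Proof.
move=> lw wc; elim: j => //= j [lj jc].
by rewrite legal_cat pi_word_cat lw wc lj jc.
Qed.

Hypothesis irr : locally_irreducible N.
Variable P : 'M[rat]_#|alphabet N|.
Hypothesis prodP : production_matrix P.
Hypothesis conP : strongly_connected P.
Variable s : intvec N.
Hypothesis s_gt0 : forall a, 0 < s a.
Hypothesis sP : (colv s)^T *m P = (colv s)^T.

(** As the entries of [s] are at least 1, a fixed value of $s\cdot x+h(q)$ and a lower bound on the
    counts bound them above too, leaving finitely many configurations. *)
Lemma pigeonhole_config (f : nat -> config N) (B E : int) (h : states N -> int) :
  (forall i a, B <= (f i).1 a) ->
  (forall i, sdot s (f i).1 + h (f i).2 = E) ->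
  exists i j, (i < j)%N /\ f i = f j.
Proof.
move=> fB fE; pose D : int := E + \sum_q `|h q| - \sum_a s a * B.
have ub i a : (f i).1 a - B <= D.
  apply: le_trans (_ : s a * ((f i).1 a - B) <= _).
    by rewrite ler_peMl ?subr_ge0 // -gtz0_ge1.
  apply: le_trans (_ : \sum_b s b * ((f i).1 b - B) <= _).
    rewrite (bigD1 a) //= lerDl sumr_ge0 // => b _.
    by rewrite mulr_ge0 ?subr_ge0 // ltW.
  under eq_bigr do rewrite mulrBr.
  rewrite sumrB lerD2r -/(sdot s _) -(fE i) -addrA lerDl.
  rewrite (bigD1 (f i).2) //= addrA addr_ge0 ?sumr_ge0 //.
  by rewrite -lerBlDl sub0r ler_normr lexx orbT.
have code_bound i a : (`|((f i).1 a - B)%R| < `|D|.+1)%N.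
  have fB0 : 0 <= (f i).1 a - B by rewrite subr_ge0.
  by rewrite ltnS -lez_nat !gez0_abs ?ub // (le_trans fB0).
(* Counts are coded by their excess over [B], which lies between 0 and [D]. *)
pose T := ({ffun alphabet N -> 'I_(`|D|.+1)} * states N)%type.
pose F i : T := ([ffun a => inord `|(f i).1 a - B|], (f i).2).
have /injectivePn[i [j ij Fij]] : ~~ injectiveb (fun i : 'I_#|{: T}|.+1 => F i).
  by apply/negP => /injectiveP/leq_card; rewrite card_ord ltnn.
have fij : f i = f j.
  move: Fij => [/ffunP xx qq]; rewrite (surjective_pairing (f i)).
  rewrite (surjective_pairing (f j)) qq; congr (_, _); apply/ffunP => a.
  have := xx a; rewrite !ffunE => /(congr1 val); rewrite /= !inordK //.
  by move=> /(congr1 Posz); rewrite !gez0_abs ?subr_ge0 //; exact: addIr.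
case: (ltngtP i j) => [lij|lji|/val_inj/eqP]; first by exists i, j.
  by exists j, i.
by rewrite (negPf ij).
Qed.

Lemma config_lower_bound x : exists B : int, forall a, B <= Num.min (x a) 0.
Proof.
exists (- \sum_a `|x a|) => a; rewrite le_min oppr_le0 sumr_ge0 ?andbT //.
rewrite (bigD1 a) //= opprD; apply: le_trans (_ : - `|x a| <= _).
  by rewrite gerDl oppr_le0 sumr_ge0.
by rewrite lerNl ler_normr lexx orbT.
Qed.

Lemma forward_walk_cycle (f : nat -> config N) :
  (forall k, exists a, exec [:: a] (f k) (f k.+1)) ->
  exists i, cyclic_config (f i).
Proof.
move=> step; have [h hE] := invariant_exists irr prodP sP.
have [B fB] := config_lower_bound (f 0%N).1.
have to_f i : exists2 w, size w = i & exec w (f 0%N) (f i).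
  by apply: exec_chain => k _; exact: step.
have [|i|i [j [ij fij]]] :=
  @pigeonhole_config f B (sdot s (f 0%N).1 + h (f 0%N).2) h.
- move=> i a; have [w _ [lw <-]] := to_f i.
  exact: le_trans (fB a) (pi_word_min _ lw).
- by have [w _ [_ <-]] := to_f i; exact: hE.
exists i; have [|w ws wE] := @exec_chain (fun k => f (i + k)%N) (j - i).
  by move=> k _; have [a ?] := step (i + k)%N; exists a; rewrite addnS.
exists w; first by move=> w0; move: ws ij; rewrite w0 /= -subn_gt0 => <-.
by move: wE; rewrite addn0 subnKC 1?ltnW // -fij.
Qed.

(** A nonhalting configuration always has a letter to execute and stays nonhalting, so a legal walk
    goes on forever and must repeat. *)
Lemma nonhalting_reaches_cyclic c : ~ halts c ->
  exists2 r, reaches c r & cyclic_config r.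
Proof.
move=> nc.
have nextE d : exists d', ~ halts d -> exists a, exec [:: a] d d'.
  have [hd|/not_halts_step[a da]] := pselect (halts d); first by exists d.
  by exists (pi_step a d) => _; exists a; split; rewrite //= da.
have [g gE] := choice nextE.
have nf i : reaches c (iter i g c) /\ ~ halts (iter i g c).
  elim: i => [|i [ri ni]] /=; first by split => //; exact: reaches_refl.
  have [a aE] := gE _ ni; have rg : reaches c (g (iter i g c)).
    by apply: reaches_trans ri _; exists [:: a].
  split=> // hg; apply: nc; have [d gd d0] := hg.
  by exists d => //; exact: reaches_trans gd.
have [|i ci] := @forward_walk_cycle (fun i => iter i g c).
  by move=> k; apply: gE; case: (nf k).
by exists (iter i g c) => //; case: (nf i).
Qed.

(** With no initial configuration, the lower bound comes from diversity: each letter was executed at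
    some earlier time, after which its count stays nonnegative. *)
Lemma backward_walk_cycle (y : int -> config N) (l : int -> alphabet N) :
  (forall i, i <= 0 -> exec [:: l i] (y (i - 1)) (y i)) ->
  diverse [set i | i <= 0] l -> exists i, i <= 0 /\ cyclic_config (y i).
Proof.
move=> step div; have [h hE] := invariant_exists irr prodP sP.
have chain (i : int) n : i + n%:Z <= 0 ->
    exists2 w, size w = n & exec w (y i) (y (i + n%:Z)).
  move=> in0; have [|w wn wE] := @exec_chain (fun k => y (i + k%:Z)) n.
    move=> k kn; exists (l (i + k.+1%:Z)).
    have := step (i + k.+1%:Z); rewrite -addn1 PoszD addrA addrK; apply.
    by apply: le_trans in0; rewrite -addrA lerD2l -PoszD lez_nat addn1.
  by exists w => //; rewrite -[y i](congr1 y (addr0 i)).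
have y_ge0 (i : nat) a : 0 <= (y (- i%:Z)).1 a.
  have [k [ki lk]] : exists k : int, k <= - i%:Z /\ l k = a.
    apply: contrapT => nk; apply: (div a).
    apply: (sub_finite_set _ (finite_image (fun m : nat => - m%:Z) (finite_II i))).
    move=> k [_ /= k0 lk]; exists `|k|%N; last by rewrite lez0_abs ?opprK.
    rewrite -ltz_nat lez0_abs // ltrNl ltNge; apply/negP => ki; apply: nk.
    by exists k.
  have k0 : k <= 0 by apply: le_trans ki _; rewrite oppr_le0.
  have [/= /andP[yk _] kE] := step k k0.
  have [|w _ [lw wE]] := chain k `|- i%:Z - k|%N.
    by rewrite gez0_abs ?subr_ge0 // addrCA subrr addr0 oppr_le0.
  rewrite gez0_abs ?subr_ge0 // addrCA subrr addr0 in wE.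
  rewrite -wE; apply: le_trans (pi_word_min _ lw).
  rewrite le_min lexx andbT -kE !ffunE /= lk eqxx addn0.
  by rewrite -addrA addrCA addr_ge0 // subr_ge0 -lk.
have inv i : sdot s (y (- i%:Z)).1 + h (y (- i%:Z)).2 = sdot s (y 0).1 + h (y 0).2.
  have [|w _ [_ wE]] := chain (- i%:Z) i; first by rewrite addNr.
  by rewrite addNr in wE; rewrite -wE hE.
have [i [j [ij yij]]] := @pigeonhole_config (fun i => y (- i%:Z)) 0 _ h y_ge0 inv.
(* Time is reversed: since [i < j], the cycle starts at index [- j]. *)
exists (- j%:Z); rewrite oppr_le0; split=> //.
have [|w ws wE] := chain (- j%:Z) (j - i)%N.
  by rewrite addrC -subzn 1?ltnW // addrAC subrr add0r oppr_le0.
exists w; first by move=> w0; move: ws ij; rewrite w0 /= -subn_gt0 => <-.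
by move: wE; rewrite addrC -subzn 1?ltnW // addrAC subrr add0r yij.
Qed.

(** A loop contains every letter, so [size u] repetitions dominate [u]. *)
Lemma cyclic_big_loop r u : cyclic_config r ->
  exists v, [/\ legal v r, pi_word v r = r &
    forall a, (count_mem a u <= count_mem a v)%N].
Proof.
move=> [w w0 [lw wE]]; have [_ _ fw] := loop_kernel irr prodP conP w0 wE.
exists (flatten (nseq (size u) w)).
have [lj jE] := legal_power (size u) lw wE; split=> // a.
rewrite count_power (leq_trans (count_size _ _)) // leq_pmulr //.
by rewrite -has_count has_pred1.
Qed.

(** Go legally to a cyclic configuration, then around a loop dominating [u]. By [reaches_sub] the
    endpoint is also reached legally from [pi_word u c], even if [u] is illegal. *)
Lemma nonhalting_related c u : ~ halts c -> legally_related c (pi_word u c).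
Proof.
move=> /nonhalting_reaches_cyclic[r [v [lv vE]] cr].
have [t [lt tE ut]] := cyclic_big_loop u cr.
exists (pi_word (v ++ t) c); split.
  by exists (v ++ t); split=> //; rewrite legal_cat lv vE.
apply: reaches_sub => [|a]; first by rewrite legal_cat lv vE.
by rewrite count_cat (leq_trans (ut a)) // leq_addl.
Qed.

Lemma cyclic_reaches r d : cyclic_config r -> legally_related r d ->
  reaches d r.
Proof.
move=> cr [e [[u [lu uE]] de]]; apply: reaches_trans de _.
have [v [lv vE uv]] := cyclic_big_loop u cr.
by have := reaches_sub lv uv; rewrite uE vE.
Qed.

Lemma cyclic_not_halts r : cyclic_config r -> ~ halts r.
Proof.
move=> cr [d rd d0].
have dr : reaches d r by apply: cyclic_reaches => //; exists d; split=> //;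
  exact: reaches_refl.
have := stuck_reaches d0 dr => rdE; case: cr => [[//|a w] _ [/= /andP[+ _] _]].
by rewrite rdE => /le_trans/(_ (d0 a)).
Qed.

Lemma cyclic_Loc r : cyclic_config r -> Loc r.2.
Proof. by move=> [w w0 [_ wE]]; exact: (loop_Loc irr prodP conP w0 wE). Qed.

(** The loop executes [a] legally, and from then on the count of [a] is nonnegative. *)
Lemma cyclic_ge0 r a : cyclic_config r -> 0 <= r.1 a.
Proof.
move=> [w w0 [lw wE]]; have [_ _ fw] := loop_kernel irr prodP conP w0 wE.
have /splitPr wa := fw a; case: wa lw wE => w1 w2.
rewrite legal_cat => /andP[_ /= /andP[a1 lw2]]; rewrite pi_word_cat /= => <-.
apply: le_trans (pi_word_min _ lw2); rewrite le_min lexx andbT !ffunE /= eqxx.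
by rewrite addn0 -addrA addrCA addr_ge0 // subr_ge0.
Qed.

Lemma recurrent_configP r : recurrent_config r <-> cyclic_config r.
Proof.
split=> [[[w w0 lw] rr]|cr].
  have [|v [lv vE]] := rr (pi_word w r).
    by exists (pi_word w r); split; [exists w | exact: reaches_refl].
  exists (w ++ v); first by case: w w0 {lw lv vE}.
  by split; rewrite ?legal_cat ?pi_word_cat ?lw.
split=> [|d]; last exact: cyclic_reaches.
by case: cr => w w0 [lw _]; exists w.
Qed.

Lemma recurrent_component_nonhalting (C : set (config N)) c :
  recurrent_component C -> C c -> ~ halts c.
Proof.
move=> [[c0 _ <-] [I [y [l [rI [yC ystep] dl]]]]] c0c.
suff [r [Cr cr]] : exists r, component c0 r /\ cyclic_config r.
  move=> hc; apply: (cyclic_not_halts cr); apply: halts_related hc.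
  exact: legally_related_trans (legally_related_sym c0c) Cr.
have fwd : (forall i, 0 <= i -> I i) ->
    exists r, component c0 r /\ cyclic_config r.
  move=> Ige; have [k|i ci] := @forward_walk_cycle (fun i => y i%:Z).
    exists (l k.+1%:Z); have := ystep k.+1%:Z; rewrite -addn1 PoszD addrK.
    by apply; exact: Ige.
  by exists (y i); split=> //; apply/yC/Ige.
case: rI => IE; [|by apply: fwd; rewrite IE..].
rewrite IE in ystep dl yC.
have [|i [i0 ci]] := @backward_walk_cycle y l _ dl.
  move=> i i0; apply: ystep => //=; apply: le_trans i0.
  by rewrite gerDl.
by exists (y i); split=> //; exact: yC.
Qed.

Lemma cyclic_recurrent_component r :
  cyclic_config r -> recurrent_component (component r).
Proof.
move=> cr; split; first by exists r.
case: cr (cr) => w w0 [lw wE] cr.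
have [_ _ fw] := loop_kernel irr prodP conP w0 wE.
have [a0 _] : exists a0, a0 \in w.
  by case: w w0 {lw wE fw} => // a w _; exists a; rewrite mem_head.
have n0 : (0 < size w)%N by case: w w0 {lw wE fw}.
(* The walk repeats [w] periodically. The step into index [i] carries letter number [i - 1] modulo
   the length, whence the shift in [l]. *)
pose y (i : int) := pi_word (take (`|i| %% size w) w) r.
pose l (i : int) := nth a0 w (`|i - 1|%N %% size w).
exists [set i | 0 <= i], y, l; split; first by apply: Or32.
  split=> [i _|i /= i1 i0].
    exists (y i); split; last exact: reaches_refl.
    exists (take (`|i| %% size w) w); split=> //.
    move: lw; rewrite -{1}(cat_take_drop (`|i| %% size w) w) legal_cat.
    by move=> /andP[].
  rewrite /y /l; have -> : `|i|%N = `|i - 1|%N.+1.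
    by apply/eqP; rewrite -eqz_nat -addn1 PoszD !gez0_abs ?subrK.
  move: `|i - 1|%N => m; have km : (m %% size w < size w)%N by rewrite ltn_mod.
  have tE : pi_word (take (m.+1 %% size w) w) r =
      pi_word (take (m %% size w).+1 w) r.
    rewrite -addn1 -modnDml; case: (ltngtP (m %% size w).+1 (size w)) => h.
    - by rewrite addn1 modn_small.
    - by move: (leq_ltn_trans km h); rewrite ltnn.
    - by rewrite addn1 h modnn take0 take_size wE.
  rewrite tE (take_nth a0) // -cats1; split; last by rewrite pi_word_cat.
  have := lw; rewrite -{1}(cat_take_drop (m %% size w) w) legal_cat => /andP[_].
  by rewrite (drop_nth a0) //= => /andP[-> _].
move=> a fin; pose p := index a w; have pw : (p < size w)%N by rewrite index_mem.
(* One occurrence of [a] in each period: an injection of the naturals into the indices labelled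
   [a]. *)
pose g (t : nat) : int := (t * size w + p)%N.+1%:Z.
apply: infinite_nat.
have <- : g @^-1` [set i | [/\ 0 <= i - 1, 0 <= i & l i = a]] = setT.
  apply/seteqP; split=> // t _.
  rewrite /g /= -addn1 PoszD addrK /l addrK; split=> //.
  by rewrite modnMDl modn_small // nth_index.
apply: finite_preimage fin => t t' _ _ [/addIn/eqP]; rewrite eqn_pmul2r //.
by move/eqP.
Qed.

Lemma recurrent_componentP c : recurrent_component (component c) <-> ~ halts c.
Proof.
split=> [rc|/nonhalting_reaches_cyclic[r rr cr]].
  exact: recurrent_component_nonhalting rc (legally_related_refl c).
have -> : component c = component r; last exact: cyclic_recurrent_component.
by apply/component_eqP; exists r; split=> //; exact: reaches_refl.
Qed.

End Cycles.

(** * Capacity, levels and the rational image of $I-P$ *)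

(** A nonempty set of integers bounded by [B] has a maximum, namely [B - n] for the least possible
    [n], so [supremum] avoids its default value. *)
Lemma int_supremum (A : set int) (B : int) : A !=set0 ->
  (forall x, A x -> x <= B) ->
  A (supremum 0 A) /\ forall x, A x -> x <= supremum 0 A.
Proof.
move=> [x0 Ax0] AB.
have exP : exists n : nat, `[< A (B - n%:Z) >].
  exists `|B - x0|%N; apply/asboolP.
  by rewrite gez0_abs ?subr_ge0 ?AB // opprB addrCA subrr addr0.
pose m := B - (ex_minn exP)%:Z.
have Am : A m by rewrite /m; case: ex_minnP => n /asboolP.
have mub x : A x -> x <= m.
  move=> Ax; have Bx : 0 <= B - x by rewrite subr_ge0 AB.
  rewrite /m; case: ex_minnP => n _ /(_ `|B - x|%N).
  rewrite gez0_abs // opprB addrCA subrr addr0 => /(_ (asboolT Ax)).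
  by rewrite -lez_nat gez0_abs // lerBrDl addrC -lerBrDl.
have supm : supremums A m by split=> // y; apply.
suff -> : supremum 0 A = m by [].
rewrite /supremum; case: eqP => [A0|_]; first by move: Ax0; rewrite A0.
case: xgetP => [y _ [yub ylb]|/(_ m)//]; apply/eqP.
by rewrite eq_le yub // ylb.
Qed.

Section Levels.
Variables (G : digraph) (N : abelian_network G).
Implicit Types (a b : alphabet N) (w u v : seq (alphabet N)).
Implicit Types (q : states N) (x z : intvec N).
Implicit Types (c d r : config N).

Lemma bezout_sdot (s : intvec N) (m : int) :
  \big[gcdz/0]_a s a = 1 -> exists x, sdot s x = m.
Proof.
move=> s1; have [x xE] : exists x, sdot s x = \big[gcdz/0]_a s a.
  elim: index_enum => [|a r [x xE]].
    by exists 0; rewrite big_nil sdot0.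
  rewrite big_cons; have [u [v <-]] := Bezoutz (s a) (\big[gcdz/0]_(i <- r) s i).
  exists [ffun b => u * (b == a)%:Z + v * x b]; rewrite -xE /sdot mulr_sumr.
  under eq_bigr do rewrite ffunE mulrDr.
  rewrite big_split (bigD1 a) //= big1 => [|b /negPf ->]; last by rewrite !mulr0.
  rewrite eqxx mulr1 addr0 mulrC; congr (_ + _).
  by apply: eq_bigr => b _; rewrite mulrCA.
exists [ffun a => m * x a]; rewrite -[RHS]mulr1 -s1 -xE mulr_sumr.
by apply: eq_bigr => a _; rewrite ffunE mulrCA.
Qed.

Hypothesis irr : locally_irreducible N.
Variable P : 'M[rat]_#|alphabet N|.
Hypothesis prodP : production_matrix P.
Hypothesis conP : strongly_connected P.
Variable s : intvec N.
Hypothesis exs : exchange_rate P s.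

Let s_gt0 a : 0 < s a. Proof. by case: exs. Qed.
Let sP : (colv s)^T *m P = (colv s)^T. Proof. by case: exs. Qed.
Let s_gcd : \big[gcdz/0]_a s a = 1. Proof. by case: exs. Qed.

(** At the halting point the [s]-weight is at most 0, and by conservation the initial weight exceeds
    it only by a difference of two values of [h]. *)
Lemma halts_bounded : exists B, forall c, halts c -> sdot s c.1 <= B.
Proof.
have [h hE] := invariant_exists irr prodP sP.
exists (\sum_q `|h q| + \sum_q `|h q|) => c [d [w [_ wE]] d0].
have := hE w c; rewrite wE => e.
have hb q : `|h q| <= \sum_q `|h q|.
  by rewrite (bigD1 q) //= lerDl sumr_ge0.
have -> : sdot s c.1 = sdot s d.1 + (h d.2 - h c.2) by rewrite addrA e addrK.
rewrite -[leRHS]add0r lerD //.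
  rewrite -oppr_ge0 -sumrN sumr_ge0 // => a _.
  by rewrite -mulrN mulr_ge0 ?oppr_ge0 // ltW.
rewrite lerD //; first exact: le_trans (ler_norm _) (hb _).
by rewrite (le_trans (ler_norm _)) // normrN.
Qed.

Lemma nonhalting_exists q : exists x, ~ halts (x, q).
Proof.
have [B HB] := halts_bounded; have [x xE] := bezout_sdot (B + 1) s_gcd.
by exists x => /HB /=; rewrite xE gerDl.
Qed.

(** Any loop found at a cyclic configuration works, by [kernel_fixed_loop]. It makes execution over
    [Loc] reversible. *)
Lemma universal_loop : exists w, (forall a, a \in w) /\
  forall c, Loc c.2 -> pi_word w c = c.
Proof.
have [q _] := Loc_nonempty N; have [x nx] := nonhalting_exists q.
have [r _ [w w0 [_ wE]]] := nonhalting_reaches_cyclic irr prodP s_gt0 sP nx.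
have [Kw Pw fw] := loop_kernel irr prodP conP w0 wE.
by exists w; split=> // c; exact: kernel_fixed_loop Kw Pw.
Qed.

Lemma halts_pi_Loc w c : Loc c.2 -> halts (pi_word w c) <-> halts c.
Proof.
move=> Lc; split=> [|hc]; first exact: halts_pi.
elim: w c Lc hc => //= a w IH c Lc /haltsP[v vc].
apply: IH; first exact: (Loc_tword [:: a]).
have [t [ft tE]] := universal_loop.
(* The rest of the universal loop undoes [a], after which [v] halts as before. *)
apply/haltsP; exists (rem a t ++ v) => b; rewrite pi_word_cat pi_word_rem //.
by rewrite tE.
Qed.

Lemma cap_max c :
  (exists2 z, halts (z + c.1, c.2) & sdot s z = cap s c) /\
  (forall z, halts (z + c.1, c.2) -> sdot s z <= cap s c).
Proof.
have [B HB] := halts_bounded.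
have [||[z hz zE] ub] := @int_supremum
    [set sdot s z | z in [set z | halts (z + c.1, c.2)]] (B - sdot s c.1).
(* Removing all letters halts at once, so the set is nonempty. *)
- exists (sdot s (- c.1)), (- c.1) => //=; rewrite addNr.
  by exists (0, c.2); [exact: reaches_refl | move=> a; rewrite ffunE].
- by move=> _ [z /HB /= hz <-]; rewrite lerBrDr -sdotD.
split; first by exists z.
by move=> y hy; apply: ub; exists y.
Qed.

Lemma cap_le_capN q : cap s (0, q) <= capN s.
Proof.
have [||_ ub] := @int_supremum [set cap s (0, q) | q in setT]
    (\sum_q `|cap s (0, q)|).
- by exists (cap s (0, q)), q.
- move=> _ [p _ <-]; rewrite (bigD1 p) //=.
  by apply: le_trans (ler_norm _) _; rewrite lerDl sumr_ge0.
by apply: ub; exists q.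
Qed.

Lemma lvl_translate z c : lvl s (translate z c) = lvl s c + sdot s z.
Proof.
have [[y hy yE] ub] := cap_max c.
have [[y' hy' yE'] ub'] := cap_max (translate z c).
suff e : cap s (translate z c) = cap s c - sdot s z.
  by rewrite /lvl e opprB addrA addrAC.
apply/eqP; rewrite eq_le; apply/andP; split.
  rewrite lerBrDr -yE' -sdotD; apply: ub.
  by move: hy'; rewrite /translate /= addrA addrAC.
rewrite -yE -sdotB; apply: ub'.
by rewrite /translate /= addrACA addNr addr0.
Qed.

Lemma lvl_pi_word w c : Loc c.2 -> lvl s (pi_word w c) = lvl s c.
Proof.
move=> Lc; rewrite /lvl /cap; congr (_ - supremum _ (_ @` _)).
apply/seteqP; split=> z /=.
  have -> : (z + (pi_word w c).1, (pi_word w c).2) = pi_word w (translate z c).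
    by rewrite pi_word_translate addrC.
  by move/halts_pi; rewrite /translate addrC.
move=> hz; rewrite addrC -/(translate z _) -pi_word_translate.
by apply/halts_pi_Loc => //; rewrite /translate addrC.
Qed.

Lemma lvl_ge0 c : (forall a, 0 <= c.1 a) -> 0 <= lvl s c.
Proof.
move=> c0; have [[z hz zE] _] := cap_max c; have [_ ub] := cap_max (0, c.2).
rewrite subr_ge0; apply: le_trans (cap_le_capN c.2); rewrite -zE; apply: ub.
by rewrite /= addr0; apply: (@halts_le _ _ c.1 (z, c.2)).
Qed.

Lemma halts_stoppable c (m : nat) : halts c -> Loc c.2 -> lvl s c = m%:Z ->
  stoppable s m.
Proof.
move=> [d [w [_ wE]] d0] Lc cm; exists d; split=> //.
  by rewrite -wE pi_word2; exact: Loc_tword.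
by rewrite -cm -wE lvl_pi_word.
Qed.

(** With [F j] the largest ratio of entries of [y] to those of [s], the vector $F_j s-y$ is fixed
    and nonnegative and vanishes at [j], so it is zero by positivity. *)
Lemma fixed_covector_unique (y : 'rV[rat]_#|alphabet N|) : y *m P = y ->
  exists t, y = t *: (colv s)^T.
Proof.
move=> yP; have [i0 _|no] := pickP 'I_#|alphabet N|; last first.
  by exists 0; apply/rowP => i; have := no i.
have sp i : 0 < (colv s)^T 0 i by rewrite !mxE ltr0z.
pose F i := y 0 i / (colv s)^T 0 i.
have [j _ jmax] := @Order.TotalTheory.arg_maxP _ _ _ i0 xpredT F isT.
exists (F j); apply/eqP; rewrite eq_sym -subr_eq0; apply: contraT => v0.
have vE i : (F j *: (colv s)^T - y) 0 i = F j * (colv s)^T 0 i - y 0 i.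
  by rewrite mxE [X in X + _]mxE [X in _ + X]mxE.
have v_ge0 i : 0 <= (F j *: (colv s)^T - y) 0 i.
  by rewrite vE subr_ge0 -ler_pdivrMr ?sp //; exact: jmax.
have vP : (F j *: (colv s)^T - y) *m P = F j *: (colv s)^T - y.
  by rewrite mulmxBl yP -scalemxAl sP.
have := fixed_covector_pos prodP conP v_ge0 vP v0 j.
by rewrite vE mulfVK ?gt_eqF // subrr ltxx.
Qed.

Lemma common_denominator (y : 'cV[rat]_#|alphabet N|) :
  exists (m : nat) x, (0 < m)%N /\ colv x = y *+ m.
Proof.
pose D (p : pred 'I_#|alphabet N|) : int := \prod_(i | p i) denq (y i 0).
have Dp : 0 < D xpredT by rewrite prodr_gt0 // => i _; rewrite denq_gt0.
exists `|D xpredT|%N.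
exists [ffun a => D (fun i => i != enum_rank a) * numq (y (enum_rank a) 0)].
split; first by rewrite absz_gt0 gt_eqF.
apply/colP => i; rewrite mulmxnE mxE ffunE enum_valK.
rewrite -mulr_natr natr_absz gtr0_norm // [D xpredT](bigD1 i) //=.
by rewrite !rmorphM /= numqE mulrC -mulrA.
Qed.

(** Over the rationals the image of $I-P$ is the hyperplane orthogonal to [s]. Clearing denominators
    and then entering [K], of finite index, gives the multiple. *)
Lemma sdot0_torsion z : sdot s z = 0 ->
  exists2 j, (0 < j)%N & lattice P (z *+ j).
Proof.
move=> z0; pose A := (1%:M - P)^T.
have /submxP[D zD] : ((colv z)^T <= A)%MS.
  rewrite submxE; apply/eqP/rowP => i; rewrite [RHS]mxE.
  (* Every column of the cokernel is a left fixed vector of [P], hence proportional to [s]. *)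
  have [t yE] : exists t, (col i (cokermx A))^T = t *: (colv s)^T.
    apply: fixed_covector_unique.
    have : A *m col i (cokermx A) = 0 by rewrite colE mulmxA mulmx_coker mul0mx.
    move/(congr1 trmx); rewrite trmx_mul trmx0 trmxK mulmxBr mulmx1.
    by move/eqP; rewrite subr_eq0 => /eqP.
  have -> : ((colv z)^T *m cokermx A) 0 i = ((colv z)^T *m col i (cokermx A)) 0 0.
    by rewrite [in RHS]colE [in RHS]mulmxA -colE [RHS]mxE.
  rewrite -[col _ _]trmxK yE -trmx_mul mxE -scalemxAl mxE sdot_colv z0.
  by rewrite mulr0z mulr0.
have {zD} zD : colv z = (1%:M - P) *m D^T by rewrite -[LHS]trmxK zD trmx_mul trmxK.
have [d [x [d0 xE]]] := common_denominator D^T.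
have [j j0 Kj] := total_kernel_finite_index x.
exists (d * j)%N; first by rewrite muln_gt0 d0.
exists (x *+ j) => //; rewrite mulrnA !colvMn xE zD.
by rewrite -!scaler_nat -!scalemxAr.
Qed.

End Levels.

(** * The torsion group and its action on recurrent components *)

Section TorsionAction.
Variables (G : digraph) (N : abelian_network G).
Implicit Types (q : states N) (x z : intvec N) (n : natvec N).
Implicit Types (c d r : config N) (C : rec_comp N).

Hypothesis irr : locally_irreducible N.
Variable P : 'M[rat]_#|alphabet N|.
Hypothesis prodP : production_matrix P.
Hypothesis conP : strongly_connected P.
Variable s : intvec N.
Hypothesis exs : exchange_rate P s.

Let s_gt0 a : 0 < s a. Proof. by case: exs. Qed.
Let sP : (colv s)^T *m P = (colv s)^T. Proof. by case: exs. Qed.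

Let nonhaltP c : recurrent_component (component c) <-> ~ halts c.
Proof. exact: (recurrent_componentP irr prodP conP s_gt0 sP). Qed.

Let related_pi c w : ~ halts c -> component (pi_word w c) = component c.
Proof.
move=> nc; apply/component_eqP/legally_related_sym.
exact: (nonhalting_related irr prodP conP s_gt0 sP).
Qed.

Lemma rec_comp_nonhalting C c : val C = component c -> ~ halts c.
Proof. by move=> Cc; apply/nonhaltP; rewrite -Cc; exact: asboolW (valP C). Qed.

Lemma rec_comp_of c : ~ halts c -> exists C, val C = component c.
Proof. by move=> /nonhaltP/asboolT rc; exists (exist _ (component c) rc). Qed.

Lemma rec_comp_cyclic C : exists2 r, cyclic_config r & val C = component r.
Proof.
have [[c _ /esym cE] _] := asboolW (valP C).
have [r rr cr] := nonhalting_reaches_cyclic irr prodP s_gt0 sP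
  (rec_comp_nonhalting cE).
exists r => //; rewrite cE; apply/component_eqP; exists r; split=> //.
exact: reaches_refl.
Qed.

Lemma val_phi n C c : val C = component c ->
  val (phi n C) = component (translate (toint n) c).
Proof. by move=> Cc; rewrite /= Cc shift_component. Qed.

Lemma related_latticeP x x' q : Loc q -> ~ halts (x, q) -> ~ halts (x', q) ->
  component (x, q) = component (x', q) <-> lattice P (x - x').
Proof.
move=> Lq nx nx'; split.
  move=> /component_eqP[e [[u [_ uE]] [v [_ vE]]]].
  by apply: (lattice_pi_word irr prodP (u := u) (v := v) Lq); rewrite uE vE.
move=> /(pi_word_lattice irr prodP Lq)[u [v uv]].
by rewrite -(related_pi u) // uv related_pi.
Qed.

(** Agreement at a single component already amounts to the lattice condition, which does not mention
    the component. *)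
Lemma phi_lattice n n' : phi n = phi n' :> (rec_comp N -> rec_comp N) <->
  lattice P (toint n - toint n').
Proof.
have H C : phi n C = phi n' C <-> lattice P (toint n - toint n').
  have [[x q] cr CE] := rec_comp_cyclic C.
  have Lq : Loc q by exact: (cyclic_Loc irr prodP conP cr).
  have E := val_phi n CE; have E' := val_phi n' CE.
  have := related_latticeP Lq (rec_comp_nonhalting E) (rec_comp_nonhalting E').
  rewrite opprD addrACA subrr add0r => <-.
  by rewrite -E -E'; split=> [->//|/val_inj].
split=> [nn'|Ln]; last by apply/funext => C; apply/H.
have [q _] := Loc_nonempty N.
have [x nx] := nonhalting_exists irr prodP exs q.
by have [C _] := rec_comp_of nx; apply/(H C); rewrite nn'.
Qed.

Lemma phiM_lattice n n' : phiM n = phiM n' :> shift_monoid N <->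
  lattice P (toint n - toint n').
Proof.
split=> [/(congr1 val)/phi_lattice//|/phi_lattice e].
exact: val_inj.
Qed.

Lemma phiM_add n n' : phiM (n + n') = phiM n + phiM n' :> shift_monoid N.
Proof. exact: phiMD. Qed.

(** The common summand [m] cancels in the lattice condition: the shift monoid is cancellative. *)
Lemma groth_class_lattice n1 n1' n2 n2' :
  groth_class (phiM n1) (phiM n1') = groth_class (phiM n2) (phiM n2')
    :> groth (shift_monoid N) <->
  lattice P (toint n1 - toint n1' - (toint n2 - toint n2')).
Proof.
have e k : phiM k + phiM n1 + phiM n2' = phiM k + phiM n1' + phiM n2
    :> shift_monoid N <->
  lattice P (toint n1 - toint n1' - (toint n2 - toint n2')).
  rewrite -!phiM_add phiM_lattice !tointD.
  rewrite (_ : _ - _ = toint n1 - toint n1' - (toint n2 - toint n2')) //.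
  by rewrite !opprD opprK !addrA [LHS](+%R.[ACl (1*4)*2*5*6*3]) subrr add0r.
split=> [/groth_classP[m]|h].
  by have [k ->] := phiMP m => /e.
by apply/groth_classP; exists (phiM 0); apply/e.
Qed.

(** The homomorphism from $\mathbb Z^A$ onto the Grothendieck group, with kernel $(I-P)K$. *)
Definition shift_class z : groth (shift_monoid N) :=
  groth_class (phiM (pos_part z)) (phiM (neg_part z)).

Lemma shift_class_eq z z' :
  shift_class z = shift_class z' <-> lattice P (z - z').
Proof. by rewrite groth_class_lattice -!toint_parts. Qed.

Lemma shift_class_toint n n' :
  shift_class (toint n - toint n') = groth_class (phiM n) (phiM n').
Proof.
by apply/groth_class_lattice; rewrite -toint_parts subrr; exact: lattice0.
Qed.

Lemma shift_class_surj g : exists z, g = shift_class z.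
Proof.
elim/groth_ind: g => m m'; have [n ->] := phiMP m; have [n' ->] := phiMP m'.
by exists (toint n - toint n'); rewrite shift_class_toint.
Qed.

Lemma shift_classD z z' : shift_class (z + z') = shift_class z + shift_class z'.
Proof.
rewrite [RHS]groth_addE -!phiM_add -shift_class_toint !tointD opprD.
by rewrite addrACA -!toint_parts.
Qed.

Lemma shift_class0 : shift_class 0 = 0.
Proof.
by apply: (@addrI _ (shift_class 0)); rewrite -shift_classD !addr0.
Qed.

Lemma shift_classMn z j : shift_class (z *+ j) = shift_class z *+ j.
Proof.
by elim: j => [|j IH]; rewrite ?mulr0n ?shift_class0 // !mulrS shift_classD IH.
Qed.

Lemma shift_class_torsion z :
  torsion_pred (shift_class z) <-> sdot s z = 0.
Proof.
split=> [/asboolP[j j0]|/(sdot0_torsion prodP conP exs)[j j0 Lj]].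
  rewrite -shift_classMn -shift_class0 => /shift_class_eq; rewrite subr0.
  move=> /(sdot_lattice sP); rewrite sdotMn => /eqP; rewrite mulrn_eq0.
  by rewrite -leqn0 leqNgt j0 => /eqP.
apply/asboolP; exists j => //.
by rewrite -shift_classMn -shift_class0; apply/shift_class_eq; rewrite subr0.
Qed.

Lemma Tor_shift_class (g : Tor N) :
  exists2 z, sdot s z = 0 & val g = shift_class z.
Proof.
have [z gz] := shift_class_surj (val g); exists z => //.
by apply/shift_class_torsion; rewrite -gz; exact: valP g.
Qed.

Lemma Tor_of_shift_class z :
  sdot s z = 0 -> exists g : Tor N, val g = shift_class z.
Proof.
move=> /shift_class_torsion h.
by exists (exist (torsion_pred (U := _)) _ h).
Qed.

Lemma torsion_isomorphism : exists f : {additive ZA0_quot P s -> Tor N},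
  bijective f /\
  forall n n' (z : ZA0 s), val z = toint n - toint n' ->
    val (f (\pi_(ZA0_quot P s) z)) = groth_class (phiM n) (phiM n').
Proof.
have z0 (z : ZA0 s) : sdot s (val z) = 0 by apply/eqP; exact: valP z.
pose f (u : ZA0_quot P s) : Tor N := exist (torsion_pred (U := _)) _
  ((shift_class_torsion (val (repr u))).2 (z0 (repr u))).
have latticeE (z z' : ZA0 s) :
    \pi_(ZA0_quot P s) z = \pi z' <-> lattice P (val z - val z').
  rewrite -raddfB; split=> [/eqP|Lz].
    by rewrite -Quotient.idealrBE => /asboolW.
  by apply/eqP; rewrite -Quotient.idealrBE; apply/asboolP.
have f_pi (z : ZA0 s) : val (f (\pi_(ZA0_quot P s) z)) = shift_class (val z).
  by apply/shift_class_eq/latticeE; rewrite reprK.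
have fD : {morph f : u v / u + v}.
  move=> u v; apply: val_inj.
  have -> : u + v = \pi_(ZA0_quot P s) (repr u + repr v).
    by rewrite raddfD /= !reprK.
  by rewrite f_pi raddfD shift_classD.
have fB : zmod_morphism f.
  by move=> u v; apply: (addIr (f v)); rewrite -fD !subrK.
pose F : {additive ZA0_quot P s -> Tor N} :=
  HB.pack f (GRing.isZmodMorphism.Build _ _ f fB).
exists F; split=> [|n n' z zE]; last by rewrite [LHS]f_pi zE shift_class_toint.
have f_inj : injective f.
  by move=> u v /(congr1 val)/shift_class_eq/latticeE; rewrite !reprK.
have f_surj g : exists u, f u = g.
  have [z zs gz] := Tor_shift_class g.
  have zz : level_zero_pred s z by apply/eqP.
  exists (\pi_(ZA0_quot P s) (exist (level_zero_pred s) z zz : ZA0 s)).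
  by apply: val_inj; rewrite f_pi gz.
have [k kE] := choice f_surj.
by exists k => u; [apply: f_inj; exact: kE | exact: kE].
Qed.

(** Makes the action computable: at a locally recurrent representative, [g] acts by translation
    along any [z] of class [g]. *)
Lemma tor_imageP (g : Tor N) z C C' c : val C = component c -> Loc c.2 ->
  val g = shift_class z ->
  tor_image g C C' <-> val C' = component (translate z c).
Proof.
move=> Cc Lc gz; split=> [gCC'|C'E n n' gE].
  have [r cr C'E] := rec_comp_cyclic C'.
  have := gCC' (pos_part z) (neg_part z) gz => /(congr1 val).
  rewrite (val_phi _ Cc) (val_phi _ C'E) => /component_eqP.
  move=> [e [[u [_ uE]] [v [_ vE]]]].
  (* Removing the shift by the negative part keeps the equality of endpoints but may lose
     legality. *)
  have {uE vE} uv : pi_word u (translate z c) = pi_word v r.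
    have zc : translate z c =
        translate (- toint (neg_part z)) (translate (toint (pos_part z)) c).
      by rewrite translateD -toint_parts.
    have rE : r =
        translate (- toint (neg_part z)) (translate (toint (neg_part z)) r).
      by rewrite translateD subrr translate0.
    by rewrite zc [in RHS]rE [LHS]pi_word_translate [RHS]pi_word_translate uE vE.
  have nr : ~ halts r by exact: rec_comp_nonhalting C'E.
  (* Halting passes from [translate z c] to the common endpoint because the state is locally
     recurrent, and from there back to [r]. *)
  have nz : ~ halts (translate z c).
    by move=> hz; apply/nr/(@halts_pi _ _ v); rewrite -uv;
      apply/(halts_pi_Loc irr prodP conP exs).
  by rewrite C'E -(related_pi v nr) -uv related_pi.
have E := val_phi n Cc; have E' := val_phi n' C'E.
apply: val_inj; rewrite E E'.
apply/(related_latticeP Lc (rec_comp_nonhalting E) (rec_comp_nonhalting E')).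
have : shift_class (toint n - toint n') = shift_class z.
  by rewrite shift_class_toint -gE.
move=> /shift_class_eq; congr (lattice _ _).
by rewrite /= -(addrA c.1 z) [in RHS]opprD addrACA subrr add0r opprD addrA addrAC.
Qed.

(** The level may be read off any locally recurrent configuration, as execution preserves it over
    [Loc]. *)
Lemma rec_comp_levelP m C : rec_comp_level s m C <->
  exists c, [/\ val C = component c, Loc c.2 & lvl s c = m%:Z].
Proof.
split=> [[c [Cc /(recurrent_configP irr prodP conP) cr cm]]|[c [Cc Lc cm]]].
  exists c; split=> //; last exact: (cyclic_Loc irr prodP conP cr).
  have [c0 _ C0] := rec_comp_cyclic C; move: Cc; rewrite C0.
  by move=> /component_eqP.
have [r rr cr] := nonhalting_reaches_cyclic irr prodP s_gt0 sP
  (rec_comp_nonhalting Cc).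
exists r; split.
- by rewrite Cc; exists r; split=> //; exact: reaches_refl.
- exact/(recurrent_configP irr prodP conP).
- by case: rr => w [_ <-]; rewrite (lvl_pi_word irr prodP conP exs).
Qed.

Lemma trivIset_level : trivIset setT (rec_comp_level s).
Proof.
move=> i j _ _ [C [/rec_comp_levelP[c [Cc Lc ci]] /rec_comp_levelP[d [Cd Ld dj]]]].
move: Cc; rewrite Cd => /component_eqP[e [[u [_ uE]] [v [_ vE]]]].
apply/eqP; rewrite -eqz_nat -ci -dj -(lvl_pi_word irr prodP conP exs v) // vE.
by rewrite -uE (lvl_pi_word irr prodP conP exs).
Qed.

(** Weight-zero translation keeps the level, and a halting locally recurrent configuration would
    make that level stoppable. *)
Lemma level_translate_nonhalting (m : nat) z c : ~ stoppable s m ->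
  Loc c.2 -> lvl s c = m%:Z -> sdot s z = 0 -> ~ halts (translate z c).
Proof.
move=> nm Lc cm z0 hz; apply: nm.
apply: (halts_stoppable irr prodP conP exs hz) => //.
by rewrite (lvl_translate irr prodP exs) z0 addr0.
Qed.

Lemma tor_act_level m C c g z : ~ stoppable s m ->
  val C = component c -> Loc c.2 -> lvl s c = m%:Z ->
  sdot s z = 0 -> val g = shift_class z ->
  val (tor_act g C) = component (translate z c).
Proof.
move=> nm Cc Lc cm z0 gz.
have [C' C'E] := rec_comp_of (level_translate_nonhalting nm Lc cm z0).
apply/(tor_imageP _ Cc Lc gz).
apply: (@xgetPex _ _ [set C' | tor_image g C C']).
by exists C'; apply/(tor_imageP _ Cc Lc gz).
Qed.

Lemma move_to_state x q c : lvl s c = lvl s (x, q) -> Loc c.2 -> Loc q ->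
  exists w z, sdot s z = 0 /\ translate z (pi_word w c) = (x, q).
Proof.
move=> cx Lc Lq; have [w wq] := tword_transitive irr c.2 Lq.
pose z := x - (pi_word w c).1.
have zE : translate z (pi_word w c) = (x, q).
  by rewrite /translate pi_word2 wq addrCA subrr addr0.
exists w, z; split=> //.
have := lvl_translate irr prodP exs z (pi_word w c).
rewrite zE -cx (lvl_pi_word irr prodP conP exs) //.
by rewrite -[X in X = _]addr0 => /addrI.
Qed.

Lemma invertible_level C :
  invertible_comp C <-> exists2 m, ~ stoppable s m & rec_comp_level s m C.
Proof.
split=> [inv|[m nm /rec_comp_levelP[c [Cc Lc cm]]] g]; last first.
  have [z z0 gz] := Tor_shift_class g.
  have [C' C'E] := rec_comp_of (level_translate_nonhalting nm Lc cm z0).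
  by exists C'; apply/(tor_imageP _ Cc Lc gz).
have [r cr Cr] := rec_comp_cyclic C.
have Lr := cyclic_Loc irr prodP conP cr.
have := lvl_ge0 irr prodP exs (fun a => cyclic_ge0 irr prodP conP a cr).
case rm: (lvl s r) => [m|//] _; exists m; last by apply/rec_comp_levelP; exists r.
move=> [[x q] [x0 /= Lq cm]].
have [w [z [z0 wz]]] := move_to_state (etrans rm cm) Lr Lq.
have [g gz] := Tor_of_shift_class z0.
(* If the level were stoppable, this [g] would move [C] to a configuration that halts at [(x, q)],
   yet its component is recurrent. *)
have [C' /(tor_imageP _ Cr Lr gz) C'E] := inv g.
apply: (rec_comp_nonhalting C'E); apply: (@halts_pi _ _ w).
by rewrite pi_word_translate wz; exists (x, q); first exact: reaches_refl.
Qed.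

Lemma torsion_action m : ~ stoppable s m ->
  [/\ action_on (@tor_act G N) (rec_comp_level s m),
      free_on (@tor_act G N) (rec_comp_level s m)
    & transitive_on (@tor_act G N) (rec_comp_level s m)].
Proof.
move=> nm.
have lvlz c z : lvl s c = m%:Z -> sdot s z = 0 -> lvl s (translate z c) = m%:Z.
  by rewrite (lvl_translate irr prodP exs) => -> ->; rewrite addr0.
split; first split.
- move=> g C /rec_comp_levelP[c [Cc Lc cm]]; have [z z0 gz] := Tor_shift_class g.
  apply/rec_comp_levelP; exists (translate z c); split=> //; last exact: lvlz.
  exact: tor_act_level cm z0 gz.
- move=> C /rec_comp_levelP[c [Cc Lc cm]]; apply: val_inj.
  rewrite (tor_act_level nm Cc Lc cm (sdot0 s)) ?translate0 //.
  by rewrite shift_class0 raddf0.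
- move=> g h C /rec_comp_levelP[c [Cc Lc cm]].
  have [y y0 gy] := Tor_shift_class g; have [z z0 hz] := Tor_shift_class h.
  have zE := tor_act_level nm Cc Lc cm z0 hz; apply: val_inj.
  rewrite (tor_act_level nm zE _ (lvlz _ _ cm z0) y0 gy) // translateD.
  apply: (tor_act_level nm Cc Lc cm); first by rewrite sdotD y0 z0 addr0.
  by rewrite raddfD /= gy hz -shift_classD addrC.
- move=> g h C /rec_comp_levelP[c [Cc Lc cm]].
  have [y y0 gy] := Tor_shift_class g; have [z z0 hz] := Tor_shift_class h.
  move/(congr1 val); rewrite (tor_act_level nm Cc Lc cm y0 gy).
  rewrite (tor_act_level nm Cc Lc cm z0 hz).
  move/(related_latticeP Lc (level_translate_nonhalting nm Lc cm y0)
    (level_translate_nonhalting nm Lc cm z0)).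
  rewrite opprD addrACA subrr add0r => /shift_class_eq e.
  by apply: val_inj; rewrite gy hz.
split=> [|C D /rec_comp_levelP[c [Cc Lc cm]] /rec_comp_levelP[[x q] [Dd Ld dm]]].
  have [q Lq] := Loc_nonempty N.
  (* The entries of [s] have gcd 1, so a translation attains any prescribed level. *)
  have [y yE] := bezout_sdot (m%:Z - lvl s (0, q)) (let: And3 _ _ h := exs in h).
  have ym : lvl s (translate y (0, q)) = m%:Z.
    by rewrite (lvl_translate irr prodP exs) yE addrC subrK.
  have := level_translate_nonhalting nm (Lq : Loc (translate y (0, q)).2) ym
    (sdot0 s).
  rewrite translate0 => /rec_comp_of[C CE].
  by exists C; apply/rec_comp_levelP; exists (translate y (0, q)).
have [w [z [z0 wz]]] := move_to_state (etrans cm (esym dm)) Lc Ld.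
have [g gz] := Tor_of_shift_class z0; exists g; apply: val_inj.
rewrite (tor_act_level nm Cc Lc cm z0 gz) Dd -wz -pi_word_translate related_pi //.
exact: level_translate_nonhalting cm z0.
Qed.

End TorsionAction.

Theorem theorem5p25 (G : digraph) (N : abelian_network G)
    (P : 'M[rat]_#|alphabet N|) (s : intvec N) :
  locally_irreducible N ->
  production_matrix P ->
  strongly_connected P ->
  critical P ->
  exchange_rate P s ->
  [/\ exists f : {additive ZA0_quot P s -> Tor N},
        bijective f /\
        forall (n n' : natvec N) (z : ZA0 s),
          val z = toint n - toint n' ->
          val (f (\pi_(ZA0_quot P s) z)) = groth_class (phiM n) (phiM n'),
      [set C : rec_comp N | invertible_comp C] =
        \bigcup_(m in ~` stoppable s) rec_comp_level s m /\
      trivIset (~` stoppable s) (rec_comp_level s)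
    & forall m : nat, ~ stoppable s m ->
        [/\ action_on (@tor_act G N) (rec_comp_level s m),
            free_on (@tor_act G N) (rec_comp_level s m)
          & transitive_on (@tor_act G N) (rec_comp_level s m)]].
Proof.
move=> irr prodP conP _ exs; split.
- exact: (torsion_isomorphism irr prodP conP exs).
- split; last by move=> i j _ _; exact: (trivIset_level irr prodP conP exs).
  by apply/seteqP; split=> C /(invertible_level irr prodP conP exs C).
- exact: (torsion_action irr prodP conP exs).
Qed.
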